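(* Let $0<\alpha<1$, $0\le\beta\le 1$, $\gamma=\alpha+\beta(1-\alpha)$, $\rho>0$, $x_0\in\mathbb{R}$. Let $\varphi:\mathbb{R}^{+}\times\mathbb{R}\to\mathbb{R}$ be a continuous function (possibly with a weak singularity with respect to $t$ at $t=0$) satisfying a Lipschitz condition $|\varphi(t,x)-\varphi(t,y)|\le A|x-y|$ with a constant $A>0$. Suppose there exists a constant $0\le\lambda<1$ such that $(\mathcal{M}x)(t)=t^{\lambda}\varphi(t,x(t))$ defines a continuous bounded map from $C_{1-\gamma,\rho}[0,T]$ into $C[0,T]$, where $T$ is a positive constant. Let $x=x(t)$, $t\in(0,\mu)$, be a solution of the initial value problem $${}_{\rho}D^{\alpha,\beta}_{0+}x(t)=\varphi(t,x(t)),\quad t>0,\qquad {}_{\rho}I^{1-\gamma}_{0+}x(t)\big|_{t=0}=x_0 .$$ Then $x$ is non-continuable if and only if, for some $\zeta\in(0,\frac{\mu}{2})$ and any bounded closed subset $E\subset[\zeta,+\infty)\times\mathbb{R}$, there exists $t^{*}\in[\zeta,\mu)$ such that $(t^{*},x(t^{*}))\notin E$.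
   Context: $\mathbb{R}^+=(0,\infty)$; $0<\mu\le+\infty$. For a finite $T>0$, $C_{1-\gamma,\rho}[0,T]$ is the space of functions $x:(0,T]\to\mathbb{R}$ such that $(t^{\rho}/\rho)^{1-\gamma}x(t)$ belongs to $C[0,T]$ (i.e. extends continuously to $[0,T]$), with norm $\|x\|_{C_{1-\gamma,\rho}}=\max_{t\in[0,T]}|(t^{\rho}/\rho)^{1-\gamma}x(t)|$; $C[0,T]$ carries the sup norm. Katugampola fractional integral of order $\sigma>0$: $({}_{\rho}I^{\sigma}_{0+}x)(t)=\frac{\rho^{1-\sigma}}{\Gamma(\sigma)}\int_0^t\frac{\tau^{\rho-1}x(\tau)}{(t^{\rho}-\tau^{\rho})^{1-\sigma}}\,d\tau$, $t>0$; ${}_{\rho}I^{0}_{0+}$ is the identity. Hilfer-Katugampola fractional derivative of order $\alpha$ and type $\beta$: ${}_{\rho}D^{\alpha,\beta}_{0+}x={}_{\rho}I^{\beta(1-\alpha)}_{0+}\big(t^{1-\rho}\tfrac{d}{dt}\big)\,{}_{\rho}I^{(1-\alpha)(1-\beta)}_{0+}x$. Note $1-\gamma=(1-\alpha)(1-\beta)$. The value ${}_{\rho}I^{1-\gamma}_{0+}x(t)|_{t=0}$ is understood as the limit as $t\to0^+$. A solution on $(0,\mu)$ is a function whose restriction to $(0,b]$ lies in $C_{1-\gamma,\rho}[0,b]$ for every $b\in(0,\mu)$, satisfying the equation on $(0,\mu)$ and the initial condition. The paper treats the problem through the corresponding Volterra equation $x(t)=\frac{x_0}{\Gamma(\gamma)}(t^{\rho}/\rho)^{\gamma-1}+\frac{\rho^{1-\alpha}}{\Gamma(\alpha)}\int_0^t\frac{\tau^{\rho-1}\varphi(\tau,x(\tau))}{(t^{\rho}-\tau^{\rho})^{1-\alpha}}d\tau$.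 Continuation: if $x$ and $\hat x$ are solutions of the initial value problem on $(0,\mu)$ and $(0,\hat\mu)$ respectively, with $\mu<\hat\mu$ and $x(t)=\hat x(t)$ for $t\in(0,\mu)$, then $\hat x$ is a continuation of $x$ (and $x$ can be continued to $(0,\hat\mu)$). A solution is non-continuable if it has no continuation.
   Formalization: The derivative D^{α,β} is read in a generalized sense, as (t^{1-ρ} d/dt) I^{β(1-α)}(y − y(0+)) with y = I^{1-γ}x; with the inner derivative of y taken literally, the claim fails for merely continuous φ when β>0 (e.g. β=1). *)

(* Defs.v *)
From mathcomp Require Import all_boot all_order all_algebra.
From mathcomp Require Import all_classical all_reals all_analysis.

Set Implicit Arguments.
Unset Strict Implicit.
Unset Printing Implicit Defensive.

Import Order.TTheory GRing.Theory Num.Theory.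
Import numFieldNormedType.Exports.

Local Open Scope classical_set_scope.
Local Open Scope ring_scope.

(* Functions on (0, T] or (0, mu) are represented by total functions R -> R
   of which only the values on that interval are ever used. *)

Section Definitions.
Context {R : realType}.
Implicit Types (rho sigma alpha beta gamma lambda T t : R) (mu : \bar R).
Implicit Types (x y g : R -> R) (phi : R -> R -> R).

Definition Gamma (z : R) : R :=
  \int[lebesgue_measure]_(u in `]0, +oo[) (u `^ (z - 1) * expR (- u)).

Definition kat_int rho sigma x t : R :=
  if sigma == 0 then x t else
  rho `^ (1 - sigma) / Gamma sigma *
  \int[lebesgue_measure]_(tau in `]0, t[)
     (tau `^ (rho - 1) * x tau / (t `^ rho - tau `^ rho) `^ (1 - sigma)).

Definition value0 g : R := lim (g t @[t --> 0^'+]).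

(* In I^sigma (t^(1-rho) d/dt) y, with y = I^((1-alpha)(1-beta)) x and
   sigma = beta (1-alpha), the inner derivative is understood in the
   generalized sense.  I^sigma being a convolution in the variable
   t^rho / rho, it commutes with t^(1-rho) d/dt on functions vanishing at 0+,
   so that
     I^sigma (t^(1-rho) d/dt) y = (t^(1-rho) d/dt) I^sigma (y - y(0+)),
   an identity between functions whenever y is locally absolutely continuous
   on [0, mu).  The right-hand side is taken as the definition, as is usual
   for the Caputo derivative (beta = 1); for beta = 0 nothing changes, since
   I^0 is the identity.  A pointwise inner derivative would be too strong: for
   beta > 0 and phi merely continuous, the solutions of the Volterra equation
   need not have a differentiable y (for beta = 1, y is x itself). *)
Definition hk_primitive rho alpha beta x : R -> R :=
  let y := kat_int rho ((1 - alpha) * (1 - beta)) x in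
  kat_int rho (beta * (1 - alpha)) (fun s => y s - value0 y).

Definition hk_derivable rho alpha beta x t : Prop :=
  derivable (hk_primitive rho alpha beta x) t 1.

Definition hk_deriv rho alpha beta x t : R :=
  t `^ (1 - rho) * derive1 (hk_primitive rho alpha beta x) t.

(* The only candidate for a continuous extension to [0, T] of a function given
   on (0, T]. *)
Definition extend0 g t : R := if t == 0 then value0 g else g t.

Definition in_C T g : Prop := {within `[0, T], continuous g}.

Definition normC T g : R := sup [set `|g t| | t in `[0, T]].

Definition weighted rho gamma x t : R := (t `^ rho / rho) `^ (1 - gamma) * x t.

Definition in_Cw rho gamma T x : Prop := in_C T (extend0 (weighted rho gamma x)).

Definition normCw rho gamma T x : R :=
  normC T (extend0 (weighted rho gamma x)).

Definition opM lambda phi x : R -> R :=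
  extend0 (fun t => t `^ lambda * phi t (x t)).

(* "Bounded" is meant as for nonlinear operators: bounded sets are mapped to
   bounded sets. *)
Definition continuous_bounded_map rho gamma T (M : (R -> R) -> (R -> R)) :=
  [/\ forall x, in_Cw rho gamma T x -> in_C T (M x),
      forall x, in_Cw rho gamma T x ->
        forall e : R, 0 < e -> exists2 d : R, 0 < d &
          forall y, in_Cw rho gamma T y ->
            normCw rho gamma T (fun t => y t - x t) < d ->
            normC T (fun t => M y t - M x t) < e
    & forall B : R, exists K : R, forall x, in_Cw rho gamma T x ->
        normCw rho gamma T x <= B -> normC T (M x) <= K].

Definition is_solution rho alpha beta (x0 : R) phi mu x : Prop :=
  let gamma := alpha + beta * (1 - alpha) in
  [/\ forall b : R, 0 < b -> (b%:E < mu)%E -> in_Cw rho gamma b x,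
      forall t, 0 < t -> (t%:E < mu)%E ->
        hk_derivable rho alpha beta x t /\
        hk_deriv rho alpha beta x t = phi t (x t)
    & kat_int rho (1 - gamma) x t @[t --> 0^'+] --> x0].

Definition is_continuation rho alpha beta (x0 : R) phi mu x mu' x' : Prop :=
  [/\ is_solution rho alpha beta x0 phi mu' x', (mu < mu')%E
    & forall t, 0 < t -> (t%:E < mu)%E -> x t = x' t].

Definition non_continuable rho alpha beta (x0 : R) phi mu x : Prop :=
  ~ exists (mu' : \bar R) (x' : R -> R),
      is_continuation rho alpha beta x0 phi mu x mu' x'.

End Definitions.

(* Main.v *)
Require Import Defs.
From mathcomp Require Import all_boot all_order all_algebra.
From mathcomp Require Import all_classical all_reals all_analysis.
From mathcomp Require Import measurable_realfun.
From mathcomp Require Import ring lra.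

Set Implicit Arguments.
Unset Strict Implicit.
Unset Printing Implicit Defensive.

Import Order.TTheory GRing.Theory Num.Theory.
Import numFieldNormedType.Exports.

Local Open Scope classical_set_scope.
Local Open Scope ring_scope.

(** Since [phi] is Lipschitz in its second argument, uniformly on the whole
    line, a solution on a bounded interval can always be continued: a solution
    is non-continuable exactly when it lives on the whole half-line.  The
    equivalence follows.  If [mu = +oo] there is nothing beyond [mu], and the
    graph leaves every bounded set because [t] itself does.  If [mu] is finite,
    a continuation is continuous up to [mu], so that the graph of [x] over
    [zeta, mu) stays in a compact rectangle [continuation_bounded].

    Everything rests on [continuation_exists].  In the variable [s = t ^ rho]
    the Katugampola integrals are, up to a constant, convolutions with powers,
    written [RL a] below.  By the semigroup law [RL_semigroup] the two integrals
    of the derivative compose to a single one [hk_primitiveE], and the equation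
    becomes Abel's: with [X s = x (s ^ (1 / rho))] and [b = 1 - alpha], the
    derivative of [RL b X s - c * s ^ q] is [Phi s (X s)].  It is continued by
    [abel_equation_continuation].

    Inverting [RL b] by [RL alpha] would turn this into a Volterra equation at
    once, but the forcing [Phi s (X s)] may fail to be absolutely integrable at
    [0].  It is therefore cut off near [0].  The late part of the forcing is
    continuous and contributes [k * RL alpha (chi * Phi (X))] to [X]; what
    remains of [X], called [z], solves Abel's equation with a right-hand side
    that is [c * s ^ q + p0] from some [eta < M] on.  Such a [z] extends past
    [M] [abel_extension]: applying [RL alpha] to the right-hand side gives a
    multiple of the primitive of [z], and this is a smooth function after
    [eta], the singular kernel being integrated only over [0, eta].

    With [z] extended, the solution past [M] is the fixed point of
    [v = z + k * RL alpha (chi * Phi (v))] among the functions that agree with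
    [X] up to [eta].  If [M - eta] and the length gained past [M] are small this
    is a contraction for the sup norm [volterra_extension], which yields
    existence and also that [v] coincides with [X] up to [M]. *)

(** * Change of variables on open intervals *)

Section ChangeOfVariables.
Context {R : realType}.
Implicit Types (F f G : R -> R) (a b c d : R).
Local Notation mu := (@lebesgue_measure R).

(** The denominator [n + 3] keeps [a + shrink a b n] below [b - shrink a b n]
    from [n = 0] on. *)
Definition shrink a b n : R := (b - a) / n.+3%:R.

Lemma shrink_gt0 a b n : a < b -> 0 < shrink a b n.
Proof. by move=> ab; rewrite divr_gt0 // subr_gt0. Qed.

Lemma shrink_le a b m n : a < b -> (m <= n)%N -> shrink a b n <= shrink a b m.
Proof.
move=> ab mn.
by rewrite /shrink ler_pM2l ?subr_gt0 // lef_pV2 ?posrE // ler_nat !ltnS.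
Qed.

Lemma shrink_lt a b n : a < b -> a + shrink a b n < b - shrink a b n.
Proof.
move=> ab; have := shrink_le ab (leq0n n); rewrite {2}/shrink.
by move: ab; lra.
Qed.

Lemma shrink_small a b e : a < b -> 0 < e -> exists n, shrink a b n < e.
Proof.
move=> ab e0; exists (Num.trunc ((b - a) / e)).
rewrite /shrink ltr_pdivrMr // mulrC -ltr_pdivrMr //.
by apply: (lt_trans (truncnS_gt _)); rewrite ltr_nat !ltnS leqnSn.
Qed.

Lemma bigcup_shrink a b : a < b ->
  \bigcup_n `[a + shrink a b n, b - shrink a b n]%classic = `]a, b[%classic.
Proof.
move=> ab; apply/seteqP; split=> [x [n _]|x] /=; rewrite !in_itv /=.
  by have := shrink_gt0 n ab; lra.
move=> /andP[ax xb].
have e0 : 0 < Num.min (x - a) (b - x) by rewrite lt_min; lra.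
have [n] := shrink_small ab e0; rewrite lt_min => /andP[n1 n2].
by exists n => //=; rewrite in_itv /=; lra.
Qed.

(** Exhausting the open intervals by segments reduces the formula to the one
    for segments; on the segments nothing is singular. *)
Lemma ge0_integral_substitution_oo F f G a b c d : a < b ->
  (forall x, a < x < b -> is_derive x 1 F (f x)) ->
  (forall x, a < x < b -> {for x, continuous f}) ->
  {in `]a, b[ &, {homo F : x y / x < y}} ->
  (forall x, a < x < b -> c < F x < d) ->
  (forall y, c < y < d -> exists2 z, a < z < b & F z = y) ->
  (forall y, c < y < d -> {for y, continuous G}) ->
  (forall y, c < y < d -> 0 <= G y) ->
  (\int[mu]_(y in `]c, d[) (G y)%:E =
   \int[mu]_(x in `]a, b[) (G (F x) * f x)%:E)%E.
Proof.
move=> ab dF cf homF FI surjF cG G0.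
have {}surjF y : c < y < d -> exists x1 x2,
    [/\ a < x1 < b, a < x2 < b & F x1 < y < F x2].
  move=> /surjF[z zab <-]; exists ((a + z) / 2), ((z + b) / 2).
  by split; [lra|lra|apply/andP; split; apply: homF; rewrite ?in_itv /=; lra].
have Fi x : a < x < b -> F x \in `]c, d[ by move=> /FI; rewrite in_itv.
pose l n := a + shrink a b n; pose r n := b - shrink a b n.
have lI n : a < l n < b.
  by have := shrink_gt0 n ab; have := shrink_lt n ab; rewrite /l; lra.
have rI n : a < r n < b.
  by have := shrink_gt0 n ab; have := shrink_lt n ab; rewrite /r; lra.
have lr n : l n < r n by exact: shrink_lt.
have inI n x : l n <= x <= r n -> a < x < b by have := lI n; have := rI n; lra.
have lrle m n : (m <= n)%N -> l n <= l m /\ r m <= r n.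
  by move=> /(shrink_le ab); rewrite /l /r; lra.
have homFle x y : a < x < b -> a < y < b -> x <= y -> F x <= F y.
  move=> xab yab; rewrite le_eqVlt => /predU1P[->//|xy].
  by apply/ltW/homF; rewrite ?in_itv.
have cdF n y : F (l n) <= y <= F (r n) -> c < y < d.
  by have := FI _ (lI n); have := FI _ (rI n); lra.
have cupF : \bigcup_n `[F (l n), F (r n)]%classic = `]c, d[%classic.
  apply/seteqP; split=> [y [n _]|y] /=; rewrite !in_itv /=; first exact: cdF.
  move=> /surjF[x1 [x2 [x1ab x2ab yx]]].
  have e0 : 0 < Num.min (x1 - a) (b - x2) by rewrite lt_min; lra.
  have [n] := shrink_small ab e0; rewrite lt_min => /andP[n1 n2].
  exists n => //=; rewrite in_itv /=.
  have : F (l n) <= F x1 by apply: homFle => //; rewrite /l; lra.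
  have : F x2 <= F (r n) by apply: homFle => //; rewrite /r; lra.
  lra.
have cF x : a < x < b -> {for x, continuous F}.
  move=> xab; apply: differentiable_continuous; apply/derivable1_diffP.
  by have [] := dF x xab.
have cGF x : a < x < b -> {for x, continuous (fun x => G (F x) * f x)}.
  move=> xab; apply: continuousM; last exact: cf.
  by apply: continuous_comp; [exact: cF|apply: cG; exact: FI].
have F'E x : a < x < b -> derive1 F x = f x.
  by move=> /dF; rewrite derive1E => -[].
have seg n : (\int[mu]_(y in `[F (l n), F (r n)]) (G y)%:E =
    \int[mu]_(x in `[l n, r n]) (G (F x) * f x)%:E)%E.
  have nF' x : a < x < b -> \forall z \near x, f z = derive1 F z.
    move=> xab; have /near_in_itvoo : x \in `]a, b[ by rewrite in_itv.
    apply: filterS => z; rewrite in_itv /= => zab; by rewrite F'E.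
  have cF' x : a < x < b -> derive1 F z @[z --> x] --> derive1 F x.
    move=> xab; rewrite F'E //; apply: cvg_trans (cf _ xab).
    by apply: near_eq_cvg; exact: nF'.
  rewrite (@integration_by_substitution_increasing _ F) => //; first 1 last.
  - exact: ltW.
  - move=> x y; rewrite !in_itv /= => /inI xab /inI yab.
    by apply: homF; rewrite in_itv.
  - move=> x; rewrite in_itv /= => /andP[x1 x2]; apply: cF'.
    by apply: (inI n); rewrite !ltW.
  - apply/cvg_ex; exists (derive1 F (l n)).
    by apply: cvg_at_right_filter; exact: cF'.
  - apply/cvg_ex; exists (derive1 F (r n)).
    by apply: cvg_at_left_filter; exact: cF'.
  - split=> [x||].
    + rewrite in_itv /= => /andP[x1 x2].
      by have [] := dF x _; first by apply: (inI n); rewrite !ltW.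
    + by apply: cvg_at_right_filter; exact: cF.
    + by apply: cvg_at_left_filter; exact: cF.
  - apply: continuous_in_subspaceT => y; rewrite inE /= in_itv /= => /cdF.
    exact: cG.
  apply: eq_integral => x; rewrite inE /= in_itv /= => /inI xab.
  by rewrite !fctE F'E.
have mG : measurable_fun `]c, d[%classic (fun y => (G y)%:E).
  apply/measurable_EFinP; apply: open_continuous_measurable_fun => //.
  by move=> y; rewrite inE /= in_itv /= => /cG.
have mGF : measurable_fun `]a, b[%classic (fun x => (G (F x) * f x)%:E).
  apply/measurable_EFinP; apply: open_continuous_measurable_fun => //.
  by move=> x; rewrite inE /= in_itv /= => /cGF.
have f0 x : a < x < b -> 0 <= f x.
  move=> xab; rewrite -F'E //.
  apply: (@incr_derive1_ge0_itv _ F false true a b) => //.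
  by move=> z; rewrite inE /= in_itv /= => /dF[].
have cvgL : (\int[mu]_(y in `[F (l n), F (r n)]) (G y)%:E @[n --> \oo] -->
             \int[mu]_(y in `]c, d[) (G y)%:E)%E.
  rewrite -cupF; apply: ge0_nondecreasing_set_cvg_integral => //.
  - move=> m n mn; have [ll rr] := lrle m n mn; apply/subsetPset => y /=.
    rewrite !in_itv /= => /andP[y1 y2]; apply/andP; split.
      by apply: le_trans y1; exact: homFle.
    by apply: (le_trans y2); exact: homFle.
  - by move=> n; apply: measurable_funS mG => // y /=; rewrite !in_itv /= => /cdF.
  - by move=> n y /=; rewrite in_itv /= => /cdF; rewrite lee_fin; exact: G0.
have cvgR : (\int[mu]_(x in `[l n, r n]) (G (F x) * f x)%:E @[n --> \oo] -->
             \int[mu]_(x in `]a, b[) (G (F x) * f x)%:E)%E.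
  rewrite -(bigcup_shrink ab); apply: ge0_nondecreasing_set_cvg_integral => //.
  - move=> m n mn; have [ll rr] := lrle m n mn; apply/subsetPset => y /=.
    by rewrite !in_itv /= -/(l _) -/(r _) -/(l m) -/(r m); lra.
  - by move=> n; apply: measurable_funS mGF => // y /=; rewrite !in_itv /= => /inI.
  - move=> n y /=; rewrite in_itv /= => /inI yab.
    by rewrite lee_fin mulr_ge0 ?f0 ?G0 ?FI.
rewrite -(funext seg) in cvgR.
exact: (cvg_unique _ cvgL cvgR).
Qed.

(** The positive and the negative part are transformed separately, and an
    integral that diverges does so on both sides. *)
Lemma Rintegral_substitution_oo F f G a b c d : a < b ->
  (forall x, a < x < b -> is_derive x 1 F (f x)) ->
  (forall x, a < x < b -> {for x, continuous f}) ->
  (forall x, a < x < b -> 0 <= f x) ->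
  {in `]a, b[ &, {homo F : x y / x < y}} ->
  (forall x, a < x < b -> c < F x < d) ->
  (forall y, c < y < d -> exists2 z, a < z < b & F z = y) ->
  (forall y, c < y < d -> {for y, continuous G}) ->
  \int[mu]_(y in `]c, d[) G y = \int[mu]_(x in `]a, b[) (G (F x) * f x).
Proof.
move=> ab dF cf f0 homF FI surjF cG; rewrite /Rintegral; congr fine.
have part (H : R -> R) : (forall y, c < y < d -> {for y, continuous H}) ->
    (\int[mu]_(y in `]c, d[) maxe (H y)%:E 0%:E =
     \int[mu]_(x in `]a, b[) maxe (H (F x) * f x)%:E 0%:E)%E.
  move=> cH.
  transitivity (\int[mu]_(y in `]c, d[) (Num.max (H y) 0)%:E)%E.
    by apply: eq_integral => y _; rewrite EFin_max.
  rewrite (ge0_integral_substitution_oo ab dF) //.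
  - apply: eq_integral => x; rewrite inE /= in_itv /= => xab.
    by rewrite maxr_pMl ?f0 // mul0r EFin_max.
  - move=> y ycd; apply: (@continuous_max _ _ H (cst 0)); first exact: cH.
    exact: cvg_cst.
  - by move=> y _; rewrite le_max lexx orbT.
rewrite integralE [RHS]integralE; congr (_ - _)%E.
  under eq_integral do rewrite funeposE.
  under [RHS]eq_integral do rewrite funeposE.
  exact: (part G cG).
under eq_integral do rewrite funenegE -EFinN.
under [RHS]eq_integral do rewrite funenegE -EFinN -mulNr.
by apply: (part (fun y => - G y)) => y ycd; apply: continuousN; exact: cG.
Qed.

End ChangeOfVariables.

(** * Euler's Beta integral *)

Section Beta.
Context {R : realType}.
Implicit Types (a b e p q s t tau x y : R) (f G : R -> R).
Local Notation mu := (@lebesgue_measure R).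

Lemma continuous_powR e x : 0 < x -> {for x, continuous (@powR R ^~ e)}.
Proof.
move=> x0; apply: differentiable_continuous; apply/derivable1_diffP.
by apply: derivable_powR; rewrite in_itv /= x0.
Qed.

Lemma le_powR_neg e x y : e <= 0 -> 0 < x -> x <= y -> y `^ e <= x `^ e.
Proof.
move=> e0 x0 xy; have y0 : 0 < y by exact: lt_le_trans xy.
rewrite -[e]opprK !(powRN _ (- e)) lef_pV2 ?posrE ?powR_gt0 //.
by apply: ge0_ler_powR; rewrite ?nnegrE ?oppr_ge0 // ltW.
Qed.

Lemma one_powR e : (1 : R) `^ e = 1.
Proof. by rewrite powR1. Qed.

Lemma powR_neg_ge1 e x : e <= 0 -> 0 < x -> x <= 1 -> 1 <= x `^ e.
Proof. by move=> e0 x0 x1; rewrite (le_trans _ (le_powR_neg e0 x0 x1)) ?powR1. Qed.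

Lemma powR_root rho t : 0 < rho -> 0 <= t -> (t `^ rho) `^ rho^-1 = t.
Proof. by move=> r0 t0; rewrite -powRrM mulfV ?gt_eqF // powRr1. Qed.

Lemma powR_root' rho t : 0 < rho -> 0 <= t -> (t `^ rho^-1) `^ rho = t.
Proof. by move=> r0 t0; rewrite -powRrM mulVf ?gt_eqF // powRr1. Qed.

Section SubstitutionPower.
Variables (rho t : R).
Hypotheses (rho0 : 0 < rho) (t0 : 0 < t).

Let dF x : 0 < x < t ->
  is_derive x 1 (@powR R ^~ rho) (rho * x `^ (rho - 1)).
Proof. by move=> /andP[x0 _]; apply: is_derive1_powR. Qed.

Let cf x : 0 < x < t -> {for x, continuous (fun x => rho * x `^ (rho - 1))}.
Proof.
move=> /andP[x0 _]; apply: continuousM; first exact: cvg_cst.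
exact: continuous_powR.
Qed.

Let homF : {in `]0, t[ &, {homo (@powR R) ^~ rho : x y / x < y}}.
Proof.
move=> x y; rewrite !in_itv /= => /andP[x0 _] /andP[y0 _].
by apply: gt0_ltr_powR; rewrite // ?nnegrE ltW.
Qed.

Let FI x : 0 < x < t -> 0 < x `^ rho < t `^ rho.
Proof.
move=> /andP[x0 xt]; rewrite powR_gt0 //=.
by apply: gt0_ltr_powR; rewrite // ?nnegrE ltW.
Qed.

Let surjF y : 0 < y < t `^ rho -> exists2 z, 0 < z < t & z `^ rho = y.
Proof.
move=> /andP[y0 yt]; exists (y `^ rho^-1); last by rewrite powR_root' // ltW.
rewrite powR_gt0 //= -[ltRHS](@powR_root rho) // ?ltW //.
by apply: gt0_ltr_powR; rewrite // ?invr_gt0 // nnegrE ?powR_ge0 // ltW.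
Qed.

Lemma ge0_integral_substitution_powR G :
  (forall y, 0 < y < t `^ rho -> {for y, continuous G}) ->
  (forall y, 0 < y < t `^ rho -> 0 <= G y) ->
  (\int[mu]_(y in `]0%R, (t `^ rho)%R[) (G y)%:E =
   \int[mu]_(x in `]0%R, t[) (G (x `^ rho) * (rho * x `^ (rho - 1)))%:E)%E.
Proof. exact: ge0_integral_substitution_oo. Qed.

Lemma Rintegral_substitution_powR G :
  (forall y, 0 < y < t `^ rho -> {for y, continuous G}) ->
  \int[mu]_(y in `]0, t `^ rho[) G y =
  \int[mu]_(x in `]0, t[) (G (x `^ rho) * (rho * x `^ (rho - 1))).
Proof.
apply: Rintegral_substitution_oo => // x _.
by rewrite mulr_ge0 ?powR_ge0 // ltW.
Qed.

End SubstitutionPower.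

Section SubstitutionAffine.
Variables (p q : R).
Hypothesis pq : p < q.

Let F u : R := p + u * (q - p).

Let dF x : 0 < x < 1 -> is_derive x 1 F (q - p).
Proof.
move=> _; rewrite /F; apply: is_derive_eq.
by rewrite /GRing.scale /=; ring.
Qed.

Let cf x : 0 < x < 1 -> {for x, continuous (fun _ : R => q - p)}.
Proof. by move=> _; exact: cvg_cst. Qed.

Let homF : {in `]0, 1[ &, {homo F : x y / x < y}}.
Proof. by move=> x y _ _ xy; rewrite /F ltrD2l ltr_pM2r // subr_gt0. Qed.

Let FI x : 0 < x < 1 -> p < F x < q.
Proof. by rewrite /F => /andP[x0 x1]; move: pq; nra. Qed.

Let surjF y : p < y < q -> exists2 z, 0 < z < 1 & F z = y.
Proof.
move=> /andP[py yq]; have qp0 : 0 < q - p by rewrite subr_gt0.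
exists ((y - p) / (q - p)); last by rewrite /F divfK ?gt_eqF // addrC subrK.
by rewrite divr_gt0 ?subr_gt0 //= ltr_pdivrMr // mul1r ltrD2r.
Qed.

Lemma ge0_integral_substitution_affine G :
  (forall y, p < y < q -> {for y, continuous G}) ->
  (forall y, p < y < q -> 0 <= G y) ->
  (\int[mu]_(y in `]p, q[) (G y)%:E =
   \int[mu]_(u in `]0%R, 1%R[) (G (p + u * (q - p)) * (q - p))%:E)%E.
Proof. exact: (@ge0_integral_substitution_oo _ F (fun=> q - p)). Qed.

Lemma Rintegral_substitution_affine G :
  (forall y, p < y < q -> {for y, continuous G}) ->
  \int[mu]_(y in `]p, q[) G y =
  \int[mu]_(u in `]0, 1[) (G (p + u * (q - p)) * (q - p)).
Proof.
apply: (@Rintegral_substitution_oo _ F (fun=> q - p)) => // x _.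
by rewrite subr_ge0 ltW.
Qed.

End SubstitutionAffine.

Lemma integral01_cst (c : R) : (\int[mu]_(u in `]0%R, 1%R[) c%:E = c%:E)%E.
Proof.
rewrite (@integral_cst _ _ _ mu _ _ c%:E) //= lebesgue_measure_itv /=.
by rewrite lte_fin ltr01 sube0 mule1.
Qed.

(** The power [u ^ a] maps the unit interval onto itself, with derivative
    [a * u ^ (a - 1)]. *)
Lemma integrable_powR01 a : 0 < a ->
  mu.-integrable `]0, 1[ (fun u => (u `^ (a - 1))%:E).
Proof.
move=> a0.
have mf : measurable_fun (`]0, 1[%classic : set R) (fun u : R => (u `^ (a - 1))%:E).
  apply/measurable_EFinP; apply: measurable_funTS; exact: measurable_powR.
apply/integrableP; split => //.
under eq_integral do rewrite gee0_abs ?lee_fin ?powR_ge0 //.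
have ai : 0 <= a^-1 by rewrite invr_ge0 ltW.
rewrite (_ : (\int[mu]_(x in _) _)%E = (\int[mu]_(x in `]0%R, 1%R[) a^-1%:E)%E).
  by rewrite integral01_cst ltry.
have := @ge0_integral_substitution_powR a 1 a0 ltr01 (cst a^-1).
rewrite powR1 => -> //; last by move=> y _; exact: cvg_cst.
by apply: eq_integral => x _; rewrite /= mulKf ?gt_eqF.
Qed.

(** As for [integrable_powR01], with the map [1 - (1 - u) ^ b], which is
    increasing as well. *)
Lemma integrable_powR01B b : 0 < b ->
  mu.-integrable `]0, 1[ (fun u => ((1 - u) `^ (b - 1))%:E).
Proof.
move=> b0.
have mf : measurable_fun (`]0, 1[%classic : set R)
    (fun u : R => ((1 - u) `^ (b - 1))%:E).
  apply/measurable_EFinP; apply: measurable_funTS.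
  apply: (measurableT_comp (measurable_powR (b - 1))).
  exact: measurable_funB.
apply/integrableP; split => //.
under eq_integral do rewrite gee0_abs ?lee_fin ?powR_ge0 //.
have bi : 0 <= b^-1 by rewrite invr_ge0 ltW.
rewrite (_ : (\int[mu]_(x in _) _)%E = (\int[mu]_(x in `]0%R, 1%R[) b^-1%:E)%E).
  by rewrite integral01_cst ltry.
transitivity (\int[mu]_(x in `]0%R, 1%R[)
    (b^-1 * (b * (1 - x) `^ (b - 1)))%:E)%E.
  by apply: eq_integral => x _; rewrite mulKf ?gt_eqF.
apply/esym; apply: (@ge0_integral_substitution_oo _ (fun u => 1 - (1 - u) `^ b)
  (fun u => b * (1 - u) `^ (b - 1)) (cst b^-1) 0 1) => //.
- move=> x /andP[x0 x1].
  have dB : is_derive x 1 (fun u : R => 1 - u) (- 1).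
    by apply: is_derive_eq; rewrite add0r mul1r.
  have dP : is_derive (1 - x) 1 (@powR R ^~ b) (b * (1 - x) `^ (b - 1)).
    by apply: is_derive1_powR; rewrite subr_gt0.
  have dC := @is_derive1_comp _ (@powR R ^~ b) (fun u : R => 1 - u) x _ _ dP dB.
  rewrite (_ : b * _ = 0 - b * (1 - x) `^ (b - 1) * -1); last by ring.
  exact: (is_deriveB (is_derive_cst (1 : R) x 1) dC).
- move=> x /andP[x0 x1]; apply: continuousM; first exact: cvg_cst.
  apply: (@continuous_comp _ _ _ (fun u : R => 1 - u) (@powR R ^~ (b - 1))).
    by apply: continuousB; [exact: cvg_cst|exact: cvg_id].
  by apply: continuous_powR; rewrite subr_gt0.
- move=> x y; rewrite !in_itv /= => /andP[x0 x1] /andP[y0 y1] xy.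
  rewrite ltrD2l ltrN2; apply: gt0_ltr_powR; rewrite // ?nnegrE; lra.
- move=> x /andP[x0 x1].
  have p0 : 0 < (1 - x) `^ b by rewrite powR_gt0 // subr_gt0.
  have p1 : (1 - x) `^ b < 1.
    rewrite -[ltRHS](one_powR b).
    by apply: gt0_ltr_powR; rewrite // ?nnegrE; lra.
  by lra.
- move=> y /andP[y0 y1]; exists (1 - (1 - y) `^ b^-1); last first.
    by rewrite subKr powR_root' // ?subKr // subr_ge0 ltW.
  have p0 : 0 < (1 - y) `^ b^-1 by rewrite powR_gt0 // subr_gt0.
  have p1 : (1 - y) `^ b^-1 < 1.
    rewrite -[ltRHS](one_powR b^-1).
    by apply: gt0_ltr_powR; rewrite // ?nnegrE ?invr_gt0; lra.
  by lra.
- by move=> y _; exact: cvg_cst.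
Qed.

Definition euler_beta a b : R :=
  \int[mu]_(u in `]0, 1[) (u `^ (a - 1) * (1 - u) `^ (b - 1)).

(** The two singularities are separated: at each point one of the two factors
    is at most [2]. *)
Lemma integrable_euler_beta a b : 0 < a <= 1 -> 0 < b <= 1 ->
  mu.-integrable `]0, 1[ (fun u => (u `^ (a - 1) * (1 - u) `^ (b - 1))%:E).
Proof.
move=> /andP[a0 a1] /andP[b0 b1].
pose g (u : R) := 2 * u `^ (a - 1) + 2 * (1 - u) `^ (b - 1).
have ig : mu.-integrable `]0, 1[ (EFin \o g).
  rewrite /g (_ : _ \o _ = (fun u => 2%:E * (u `^ (a - 1))%:E)%E \+
      (fun u => 2%:E * ((1 - u) `^ (b - 1))%:E)%E)%E //.
  apply: integrableD => //; apply: integrableZl => //.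
    exact: integrable_powR01.
  exact: integrable_powR01B.
apply: le_integrable ig => //.
  apply/measurable_EFinP; apply: measurable_funTS; apply: measurable_funM.
    exact: measurable_powR.
  apply: (measurableT_comp (measurable_powR (b - 1))).
  exact: measurable_funB.
move=> u; rewrite /= in_itv /= => /andP[u0 u1].
have up : 0 <= u `^ (a - 1) by exact: powR_ge0.
have vp : 0 <= (1 - u) `^ (b - 1) by exact: powR_ge0.
have half e : 0 < e <= 1 -> (2^-1 : R) `^ (e - 1) <= 2.
  move=> /andP[e0 e1]; rewrite -[e - 1]opprK powRN -powR_inv1 ?powR_ge0 //.
  rewrite -powRrM mulrN1 opprK -[2^-1]powR_inv1 // -powRrM mulN1r opprB.
  by apply: ler1_powR; lra.
rewrite lee_fin ger0_norm ?mulr_ge0 // ger0_norm /g ?addr_ge0 ?mulr_ge0 //.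
have [u2|u2] := leP u 2^-1.
  have : (1 - u) `^ (b - 1) <= 2.
    by apply: le_trans (half b _); [apply: le_powR_neg; lra|lra].
  nra.
have : u `^ (a - 1) <= 2.
  by apply: le_trans (half a _); [apply: le_powR_neg; lra|lra].
nra.
Qed.

Lemma euler_beta_ge1 a b : 0 < a <= 1 -> 0 < b <= 1 -> 1 <= euler_beta a b.
Proof.
move=> ha hb; have -> : 1 = \int[mu]_(u in `]0, 1[) (cst (1 : R) u).
  by rewrite /Rintegral integral01_cst.
apply: le_Rintegral => //; last 2 first.
- exact: integrable_euler_beta.
- move=> u; rewrite /= in_itv /= => /andP[u0 u1].
  rewrite -[leLHS]mulr1; apply: ler_pM => //; apply: powR_neg_ge1; lra.
apply/integrableP; split; first exact/measurable_EFinP/measurable_cst.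
under eq_integral do rewrite /= normr1.
by rewrite integral01_cst ltry.
Qed.

(** The scaling [r = tau + u * (s - tau)] turns Euler's integral over
    [tau, s] into the one over the unit interval. *)
Lemma integral_euler_kernel a b tau s : 0 < a <= 1 -> 0 < b <= 1 -> tau < s ->
  (\int[mu]_(r in `]tau, s[) ((r - tau) `^ (b - 1) * (s - r) `^ (a - 1))%:E =
   (euler_beta b a * (s - tau) `^ (a + b - 1))%:E)%E.
Proof.
move=> ha hb ts; have st : 0 < s - tau by rewrite subr_gt0.
rewrite ge0_integral_substitution_affine //; first last.
- by move=> y _; rewrite mulr_ge0 ?powR_ge0.
- move=> y /andP[y0 y1]; apply: continuousM.
    apply: (@continuous_comp _ _ _ (fun u : R => u - tau) (@powR R ^~ (b - 1))).
      by apply: continuousB; [exact: cvg_id|exact: cvg_cst].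
    by apply: continuous_powR; rewrite subr_gt0.
  apply: (@continuous_comp _ _ _ (fun u : R => s - u) (@powR R ^~ (a - 1))).
    by apply: continuousB; [exact: cvg_cst|exact: cvg_id].
  by apply: continuous_powR; rewrite subr_gt0.
have betaE : ((euler_beta b a)%:E = \int[mu]_(u in `]0%R, 1%R[)
    (u `^ (b - 1) * (1 - u) `^ (a - 1))%:E)%E.
  rewrite /euler_beta /Rintegral fineK //.
  by apply: integrable_fin_num => //; exact: integrable_euler_beta.
rewrite mulrC EFinM betaE -ge0_integralZl_EFin ?powR_ge0 //.
- apply: eq_integral => u; rewrite inE /= in_itv /= => /andP[u0 u1].
  rewrite (_ : tau + u * (s - tau) - tau = u * (s - tau)); last by ring.
  rewrite (_ : s - (tau + u * (s - tau)) = (1 - u) * (s - tau)); last by ring.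
  have v0 : 0 <= 1 - u by rewrite subr_ge0 ltW.
  rewrite (powRM _ (ltW u0) (ltW st)) (powRM _ v0 (ltW st)).
  rewrite -EFinM; congr EFin.
  rewrite (_ : a + b - 1 = (b - 1) + (a - 1) + 1); last by ring.
  have nz (r : R) : (r == 0) ==> (s - tau != 0).
    by apply/implyP => _; rewrite gt_eqF.
  rewrite !(powRD (nz _)).
  rewrite powRr1 ?ltW //; ring.
- by move=> u _; rewrite lee_fin mulr_ge0 ?powR_ge0.
- by have /integrableP[] := integrable_euler_beta hb ha.
Qed.

Lemma integrable_euler_kernel a b s : 0 < a <= 1 -> 0 < b <= 1 ->
  mu.-integrable `]0, s[ (fun r => (r `^ (b - 1) * (s - r) `^ (a - 1))%:E).
Proof.
move=> ha hb; have [s0|s0] := leP s 0.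
  by rewrite set_itv_ge ?bnd_simp -?leNgt //; exact: integrable_set0.
apply/integrableP; split.
  apply/measurable_EFinP; apply: measurable_funTS; apply: measurable_funM.
    exact: measurable_powR.
  apply: (measurableT_comp (measurable_powR (a - 1))).
  exact: measurable_funB.
under eq_integral do rewrite gee0_abs ?lee_fin ?mulr_ge0 ?powR_ge0 // -{1}[X in (X `^ _ * _)%:E]subr0.
by rewrite integral_euler_kernel // ltry.
Qed.

Lemma Rintegral_euler_kernel a b s : 0 < a <= 1 -> 0 < b <= 1 -> 0 < s ->
  \int[mu]_(r in `]0, s[) (r `^ (b - 1) * (s - r) `^ (a - 1)) =
  euler_beta b a * s `^ (a + b - 1).
Proof.
move=> ha hb s0.
transitivity (\int[mu]_(r in `]0, s[)
    ((r - 0) `^ (b - 1) * (s - r) `^ (a - 1))).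
  by apply: eq_Rintegral => r _; rewrite subr0.
by rewrite /Rintegral (integral_euler_kernel ha hb s0) subr0.
Qed.

End Beta.

(** * The Riemann-Liouville integral *)

Section RiemannLiouville.
Context {R : realType}.
Implicit Types (a b e p q s t tau x y C M : R) (f g G : R -> R).
Local Notation mu := (@lebesgue_measure R).

(** The Riemann-Liouville integral of order [a] with base point [0], without
    the factor [1 / Gamma a]: the semigroup law then holds with a Beta constant,
    and all constants are collected where Katugampola integrals are expressed
    by [RL]. *)
Definition RL a f s : R :=
  \int[mu]_(r in `]0, s[) (f r * (s - r) `^ (a - 1)).

(** The weighted space of continuous functions on [(0, T]], for all [T < M] at
    once and in the variable [s]: the growth at [0] is at most that of
    [s ^ (- p)].  The growth is only asked near [0], which makes the property
    easy to establish; [tame_bound] provides it on all of [(0, b]]. *)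
Definition tame p M f : Prop :=
  (forall s, 0 < s < M -> {for s, continuous f}) /\
  exists e C, 0 < e /\ forall r, 0 < r < e -> `|f r| <= C * r `^ (- p).

Lemma continuous_segment_bound f x y :
  (forall s, x <= s <= y -> {for s, continuous f}) ->
  exists2 K, 0 <= K & forall s, x <= s <= y -> `|f s| <= K.
Proof.
move=> cf; have [xy|yx] := leP x y; last first.
  by exists 0 => // s /andP[xs sy]; move: (le_trans xs sy); rewrite leNgt yx.
have [c cxy cmax] : exists2 c, c \in `[x, y] &
    forall t, t \in `[x, y] -> `|f t| <= `|f c|.
  apply: EVT_max => //; apply: continuous_in_subspaceT => s.
  rewrite inE /= in_itv /= => /cf cfs.
  apply: (@continuous_comp _ _ _ f (fun u : R => `|u|)) => //.
  exact: norm_continuous.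
by exists `|f c| => // s sxy; apply: cmax; rewrite in_itv.
Qed.

Lemma tame_bound p M f b : 0 <= p -> tame p M f -> b < M ->
  exists2 C, 0 <= C & forall r, 0 < r <= b -> `|f r| <= C * r `^ (- p).
Proof.
move=> p0 [cf [e [C [e0 fC]]]] bM.
have [s sI|K K0 fK] := @continuous_segment_bound f (e / 2) b.
  by apply: cf; lra.
exists (Num.max C 0 + K * b `^ p).
  by rewrite addr_ge0 ?mulr_ge0 ?powR_ge0 // le_max lexx orbT.
move=> r /andP[r0 rb]; have b0 : 0 < b by exact: lt_le_trans rb.
have rp : 0 <= r `^ (- p) by exact: powR_ge0.
have m0 : 0 <= Num.max C 0 by rewrite le_max lexx orbT.
have [re|er] := ltP r e.
  have := fC r; rewrite r0 re => /(_ isT) /le_trans; apply.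
  apply: ler_wpM2r => //; apply: (@le_trans _ _ (Num.max C 0)).
    by rewrite le_max lexx.
  by rewrite lerDl mulr_ge0 ?powR_ge0.
have {}fK : `|f r| <= K by apply: fK; lra.
apply: (le_trans fK); rewrite mulrDl.
apply: (@le_trans _ _ (K * b `^ p * r `^ (- p))); last first.
  by rewrite lerDr mulr_ge0.
rewrite -[leLHS]mulr1 -mulrA; apply: ler_wpM2l => //.
rewrite -(@mulfV _ (b `^ p)) ?gt_eqF ?powR_gt0 //.
apply: ler_wpM2l; first exact: powR_ge0.
by rewrite -powRN; apply: le_powR_neg => //; rewrite oppr_le0.
Qed.

Lemma tame_ext p M f g : 0 < M -> (forall r, 0 < r < M -> f r = g r) ->
  tame p M f -> tame p M g.
Proof.
move=> M0 fg [cf [e [C [e0 fC]]]]; split.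
  move=> s sM; rewrite /prop_for /continuous_at -fg //.
  apply: cvg_trans (cf s sM); apply: near_eq_cvg.
  have /near_in_itvoo : s \in `]0, M[ by rewrite in_itv.
  by apply: filterS => z; rewrite in_itv /= => /fg ->.
exists (Num.min e M), C; split; first by rewrite lt_min e0.
move=> r /andP[r0]; rewrite lt_min => /andP[re rM].
by rewrite -fg ?r0 //; apply: fC; rewrite r0.
Qed.

Lemma tameD p M f g : tame p M f -> tame p M g -> tame p M (fun r => f r + g r).
Proof.
move=> [cf [e [C [e0 fC]]]] [cg [d [D [d0 gD]]]]; split.
  by move=> s sM; apply: continuousD; [exact: cf|exact: cg].
exists (Num.min e d), (C + D); split; first by rewrite lt_min e0.
move=> r /andP[r0]; rewrite lt_min => /andP[re rd].
rewrite mulrDl; apply: (le_trans (ler_normD _ _)).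
by apply: lerD; [apply: fC|apply: gD]; rewrite r0.
Qed.

Lemma tameZ p M k f : tame p M f -> tame p M (fun r => k * f r).
Proof.
move=> [cf [e [C [e0 fC]]]]; split.
  by move=> s sM; apply: continuousM; [exact: cvg_cst|exact: cf].
exists e, (`|k| * C); split => // r re.
by rewrite normrM -mulrA ler_wpM2l // fC.
Qed.

Lemma tameB p M f g : tame p M f -> tame p M g -> tame p M (fun r => f r - g r).
Proof.
move=> tf tg; rewrite (_ : (fun r => _) = fun r => f r + (- 1) * g r).
  by apply: tameD => //; exact: tameZ.
by apply/funext => r; rewrite mulN1r.
Qed.

Lemma bounded_tame p M f e C : 0 <= p -> 0 < e ->
  (forall s, 0 < s < M -> {for s, continuous f}) ->
  (forall r, 0 < r < e -> `|f r| <= C) -> tame p M f.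
Proof.
move=> p0 e0 cf fC; split => //; exists (Num.min e 1), C; split.
  by rewrite lt_min e0 ltr01.
move=> r /andP[r0]; rewrite lt_min => /andP[re r1].
have rC : `|f r| <= C by apply: fC; rewrite r0.
have C0 : 0 <= C := le_trans (normr_ge0 _) rC.
apply: (le_trans rC); rewrite -[leLHS]mulr1 ler_wpM2l //.
by apply: powR_neg_ge1; rewrite ?oppr_le0 // ltW.
Qed.

Lemma tame_cst p M (c : R) : 0 <= p -> tame p M (fun=> c).
Proof.
move=> p0; apply: (@bounded_tame p M (fun=> c) 1 `|c|) => // s _; exact: cvg_cst.
Qed.

Lemma tame_powR p M q : 0 <= p -> 0 <= q -> tame p M (fun r => r `^ q).
Proof.
move=> p0 q0; apply: (@bounded_tame p M _ 1 1) => //.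
  by move=> s /andP[s0 _]; exact: continuous_powR.
move=> r /andP[r0 r1]; rewrite ger0_norm ?powR_ge0 // -[leRHS](one_powR q).
by apply: ge0_ler_powR; rewrite ?nnegrE // ltW.
Qed.

Lemma eq_RL a f g s : (forall r, 0 < r < s -> f r = g r) -> RL a f s = RL a g s.
Proof.
move=> fg; apply: eq_Rintegral => r; rewrite inE /= in_itv /= => rs.
by rewrite fg.
Qed.

Lemma measurable_kernel e (s : R) :
  measurable_fun setT (fun r : R => (s - r) `^ e).
Proof.
apply: (measurableT_comp (measurable_powR e)); exact: measurable_funB.
Qed.

Lemma tame_measurable p M f s : s <= M -> tame p M f ->
  measurable_fun (`]0, s[%classic : set R) f.
Proof.
move=> sM [cf _]; apply: open_continuous_measurable_fun => // r.
rewrite inE /= in_itv /= => /andP[r0 rs]; apply: cf.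
by rewrite r0 (lt_le_trans rs).
Qed.

Section Bounds.
Variables (a p M s C : R) (f : R -> R).
Hypotheses (ha : 0 < a <= 1) (hp : 0 <= p < 1).
Hypotheses (mf : measurable_fun (`]0, s[%classic : set R) f)
           (fC : forall r, 0 < r < s -> `|f r| <= C * r `^ (- p)).

Let p01 : 0 < 1 - p <= 1. Proof. by move: hp; lra. Qed.

Let dominated r : 0 < r < s ->
  `|f r * (s - r) `^ (a - 1)| <= C * (r `^ (1 - p - 1) * (s - r) `^ (a - 1)).
Proof.
move=> rs; rewrite normrM [`|_ `^ _|]ger0_norm ?powR_ge0 // mulrA.
rewrite (_ : 1 - p - 1 = - p); last by ring.
by rewrite ler_wpM2r ?powR_ge0 // fC.
Qed.

Let idom : mu.-integrable `]0, s[
  (fun r => (C * (r `^ (1 - p - 1) * (s - r) `^ (a - 1)))%:E).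
Proof.
exact: (@integrableZl _ _ _ mu _ _ C _ (integrable_euler_kernel s ha p01)).
Qed.

Lemma RL_integrable :
  mu.-integrable `]0, s[ (fun r => (f r * (s - r) `^ (a - 1))%:E).
Proof.
apply: le_integrable idom => //.
  apply/measurable_EFinP; apply: measurable_funM => //.
  by apply: measurable_funTS; exact: measurable_kernel.
move=> r; rewrite /= in_itv /= => rs; rewrite lee_fin.
by apply: (le_trans (dominated rs)); exact: ler_norm.
Qed.

Lemma RL_bound : 0 < s -> `|RL a f s| <= C * euler_beta (1 - p) a * s `^ (a - p).
Proof.
move=> s0; apply: (le_trans (le_normr_Rintegral _ RL_integrable)) => //.
apply: (@le_trans _ _ (\int[mu]_(r in `]0, s[)
    (C * (r `^ (1 - p - 1) * (s - r) `^ (a - 1))))).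
  apply: le_Rintegral => //.
  by have := RL_integrable => /integrable_abse.
rewrite RintegralZl //; last exact: integrable_euler_kernel.
rewrite Rintegral_euler_kernel // mulrA.
by rewrite (_ : a + (1 - p) - 1 = a - p) //; ring.
Qed.

End Bounds.

Lemma tame_RL_integrable a p M f s : 0 < a <= 1 -> 0 <= p < 1 -> tame p M f ->
  s < M -> mu.-integrable `]0, s[ (fun r => (f r * (s - r) `^ (a - 1))%:E).
Proof.
move=> ha hp tf sM; have [C C0 fC] := tame_bound (proj1 (andP hp)) tf sM.
apply: (@RL_integrable a p s C) => //; first exact: tame_measurable (ltW sM) tf.
by move=> r /andP[r0 rs]; apply: fC; rewrite r0 ltW.
Qed.

Lemma RLD a p M f g s : 0 < a <= 1 -> 0 <= p < 1 -> tame p M f -> tame p M g ->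
  s < M -> RL a (fun r => f r + g r) s = RL a f s + RL a g s.
Proof.
move=> ha hp tf tg sM; rewrite /RL -RintegralD //.
- by apply: eq_Rintegral => r _; rewrite mulrDl.
- exact: tame_RL_integrable tf sM.
- exact: tame_RL_integrable tg sM.
Qed.

Lemma RLZ a p M f s k : 0 < a <= 1 -> 0 <= p < 1 -> tame p M f ->
  s < M -> RL a (fun r => k * f r) s = k * RL a f s.
Proof.
move=> ha hp tf sM; rewrite /RL -RintegralZl //.
- by apply: eq_Rintegral => r _; rewrite mulrA.
- exact: tame_RL_integrable tf sM.
Qed.

Lemma RLB a p M f g s : 0 < a <= 1 -> 0 <= p < 1 -> tame p M f -> tame p M g ->
  s < M -> RL a (fun r => f r - g r) s = RL a f s - RL a g s.
Proof.
move=> ha hp tf tg sM; rewrite /RL -RintegralB //.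
- by apply: eq_Rintegral => r _; rewrite mulrBl.
- exact: tame_RL_integrable tf sM.
- exact: tame_RL_integrable tg sM.
Qed.

End RiemannLiouville.

(** * The semigroup law *)

Section Semigroup.
Context {R : realType}.
Implicit Types (a b p s C M : R) (f : R -> R).
Local Notation mu := (@lebesgue_measure R).

Section Fubini.
Variables (a b p M s : R) (f : R -> R).
Hypotheses (a0 : 0 < a) (b0 : 0 < b) (ab1 : a + b <= 1).
Hypotheses (hp : 0 <= p < 1) (tf : tame p M f) (sM : s < M).

Let ha : 0 < a <= 1. Proof. by move: a0 b0 ab1; lra. Qed.
Let hb : 0 < b <= 1. Proof. by move: a0 b0 ab1; lra. Qed.
Let hab : 0 < a + b <= 1. Proof. by move: a0 b0 ab1; lra. Qed.

(* extended by zero, the kernels and [f] turn the iterated integral over a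
   triangle into one over the plane, to which Fubini's theorem applies *)
Let kappa (e u : R) : R := ((@powR R ^~ (e - 1)) \_ `]0, +oo[) u.
Let ft (u : R) : R := (f \_ `]0, s[) u.

Let kappa_pos e u : 0 < u -> kappa e u = u `^ (e - 1).
Proof. by move=> u0; rewrite /kappa patchE mem_set //= in_itv /= u0. Qed.

Let kappa_neg e u : u <= 0 -> kappa e u = 0.
Proof.
move=> u0; rewrite /kappa patchE memNset //= in_itv /= andbT.
by apply/negP; rewrite -leNgt.
Qed.

Let kappa_ge0 e u : 0 <= kappa e u.
Proof.
by have [u0|u0] := ltP 0 u; [rewrite kappa_pos ?powR_ge0|rewrite kappa_neg].
Qed.

Let ft_in u : 0 < u < s -> ft u = f u.
Proof. by move=> us; rewrite /ft patchE mem_set //= in_itv. Qed.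

Let ft_out u : ~~ (0 < u < s) -> ft u = 0.
Proof. by move=> /negP us; rewrite /ft patchE memNset //= in_itv. Qed.

Let mkappa e : measurable_fun setT (kappa e).
Proof.
apply/(measurable_restrictT _ _).1 => //; apply: measurable_funTS.
exact: measurable_powR.
Qed.

Let mft : measurable_fun setT ft.
Proof.
by apply/(measurable_restrictT _ _).1 => //; exact: tame_measurable (ltW sM) tf.
Qed.

Let h (z : R * R) : R := ft z.2 * (kappa b (z.1 - z.2) * kappa a (s - z.1)).

Let mh : measurable_fun setT h.
Proof.
apply: measurable_funM; first exact: (measurableT_comp mft measurable_snd).
apply: measurable_funM.
  apply: (measurableT_comp (mkappa b)).
  by apply: measurable_funB; [exact: measurable_fst|exact: measurable_snd].
apply: (measurableT_comp (mkappa a)).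
by apply: measurable_funB; [exact: measurable_cst|exact: measurable_fst].
Qed.

Let inner1 (c tau : R) : 0 < tau < s ->
  (\int[mu]_r (c * (kappa b (r - tau) * kappa a (s - r)))%:E =
   (c * (euler_beta b a * (s - tau) `^ (a + b - 1)))%:E)%E.
Proof.
move=> /andP[t0 ts].
pose g (r : R) := ((r - tau) `^ (b - 1) * (s - r) `^ (a - 1))%:E.
have gE r : (kappa b (r - tau) * kappa a (s - r))%:E = (g \_ `]tau, s[) r.
  rewrite patchE; case: ifPn.
    rewrite inE /= in_itv /= => /andP[tr rs].
    by rewrite !kappa_pos ?subr_gt0.
  rewrite notin_setE /= in_itv /= => /negP; rewrite negb_and -!leNgt.
  move=> /orP[h1|h1].
    by rewrite kappa_neg ?subr_le0 // mul0r.
  by rewrite (@kappa_neg a) ?subr_le0 // mulr0.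
have ek := integral_euler_kernel ha hb ts.
transitivity (\int[mu]_r (c%:E * (g \_ `]tau, s[) r))%E.
  by apply: eq_integral => r _; rewrite -gE.
rewrite integralZl //; first by rewrite -integral_mkcond ek -EFinM.
apply/(integrable_mkcond _ _).1 => //.
apply/integrableP; split.
  rewrite /g; apply/measurable_EFinP; apply: measurable_funTS.
  apply: measurable_funM.
    apply: (measurableT_comp (measurable_powR (b - 1))).
    exact: measurable_funB.
  exact: measurable_kernel.
under eq_integral do rewrite gee0_abs ?lee_fin ?mulr_ge0 ?powR_ge0 //.
by rewrite ek ltry.
Qed.

Let ih : (mu \x mu)%E.-integrable setT (EFin \o h).
Proof.
apply/integrable21ltyP; first exact/measurable_EFinP.
have E tau : (\int[mu]_r `|(EFin \o h) (r, tau)| =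
    ((fun tau => (euler_beta b a * `|f tau * (s - tau) `^ (a + b - 1)|)%:E)
      \_ `]0%R, s[) tau)%E.
  transitivity (\int[mu]_r (`|ft tau| * (kappa b (r - tau) * kappa a (s - r)))%:E)%E.
    apply: eq_integral => r _.
    rewrite /h /= normrM.
    by rewrite (ger0_norm (mulr_ge0 (kappa_ge0 _ _) (kappa_ge0 _ _))).
  rewrite patchE; case: ifPn.
    rewrite inE /= in_itv /= => ts; rewrite inner1 // ft_in // normrM.
    by rewrite [`|_ `^ _|]ger0_norm ?powR_ge0 //; congr EFin; ring.
  rewrite notin_setE /= in_itv /= => /negP ts.
  under eq_integral do rewrite ft_out // normr0 mul0r.
  exact: integral0.
under eq_integral do rewrite E.
rewrite -integral_mkcond.
have /integrableP[_] : mu.-integrable `]0, s[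
    (fun tau => (euler_beta b a * `|f tau * (s - tau) `^ (a + b - 1)|)%:E).
  have i1 := integrable_abse (tame_RL_integrable hab hp tf sM).
  exact: (@integrableZl _ _ _ mu _ (measurable_itv `]0, s[) (euler_beta b a) _ i1).
apply: le_lt_trans; rewrite le_eqVlt; apply/orP; left; apply/eqP.
apply: eq_integral => tau _; rewrite gee0_abs // lee_fin mulr_ge0 //.
by rewrite (le_trans ler01) // euler_beta_ge1.
Qed.

Let inner2 r : (\int[mu]_tau (h (r, tau))%:E =
  ((fun r => (RL b f r * (s - r) `^ (a - 1))%:E) \_ `]0%R, s[) r)%E.
Proof.
rewrite patchE; case: ifPn; last first.
  rewrite notin_setE /= in_itv /= => /negP rs.
  rewrite -[RHS](integral0 mu setT); apply: eq_integral => tau _.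
  rewrite /h /=; have [ts|/ft_out->] := boolP (0 < tau < s); last by rewrite mul0r.
  move: rs; rewrite negb_and -!leNgt => /orP[r0|sr].
    by rewrite (@kappa_neg b) ?mul0r ?mulr0 //; move: ts; lra.
  by rewrite (@kappa_neg a) ?mulr0 // subr_le0.
rewrite inE /= in_itv /= => /andP[r0 rs].
have ib := tame_RL_integrable hb hp tf (lt_trans rs sM).
transitivity (\int[mu]_tau (((s - r) `^ (a - 1))%:E *
   ((fun tau => (f tau * (r - tau) `^ (b - 1))%:E) \_ `]0%R, r[) tau))%E.
  apply: eq_integral => tau _; rewrite /h /= patchE; case: ifPn.
    rewrite inE /= in_itv /= => /andP[t0 tr].
    rewrite ft_in ?t0 ?(lt_trans tr) // !kappa_pos ?subr_gt0 //.
    by rewrite -EFinM; congr EFin; ring.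
  rewrite notin_setE /= in_itv /= => /negP; rewrite negb_and -!leNgt mule0.
  move=> /orP[h1|h1].
    by rewrite ft_out ?mul0r // ltNge h1.
  by rewrite (@kappa_neg b) ?subr_le0 // mul0r mulr0.
rewrite integralZl //; last exact: (integrable_mkcond _ _).1.
rewrite -integral_mkcond mulrC EFinM; congr (_ * _)%E.
by rewrite /RL /Rintegral fineK //; exact: integrable_fin_num.
Qed.

(** Exchanging the two integrations over the triangle [0 < tau < r < s] leaves
    an inner integral of two kernels, which is Euler's. *)
Lemma RL_semigroup : RL a (RL b f) s = euler_beta b a * RL (a + b) f s.
Proof.
have fub : (\int[mu]_r \int[mu]_tau (h (r, tau))%:E =
            \int[mu]_tau \int[mu]_r (h (r, tau))%:E)%E.
  exact: (Fubini ih).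
have lhs : (RL a (RL b f) s =
    fine (\int[mu]_r \int[mu]_tau (h (r, tau))%:E)%E).
  under eq_integral do rewrite inner2.
  rewrite -integral_mkcond.
  reflexivity.
rewrite lhs fub.
transitivity (\int[mu]_(r in `]0, s[)
    (euler_beta b a * (f r * (s - r) `^ (a + b - 1)))); last first.
  rewrite /RL; apply: RintegralZl; first exact: measurable_itv.
  exact: (tame_RL_integrable hab hp tf sM).
rewrite [RHS]/Rintegral integral_mkcond.
congr fine; apply: eq_integral => tau _.
rewrite patchE; case: ifPn.
  rewrite inE /= in_itv /= => ts.
  transitivity (\int[mu]_r (f tau * (kappa b (r - tau) * kappa a (s - r)))%:E)%E.
    by apply: eq_integral => r _; rewrite /h /= ft_in.
  rewrite (inner1 _ ts).
  congr EFin.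
  exact: mulrCA.
rewrite notin_setE /= in_itv /= => /negP ts.
rewrite -[RHS](integral0 mu setT); apply: eq_integral => r _.
by rewrite /h /= (ft_out ts) mul0r.
Qed.

End Fubini.

End Semigroup.

(** * Regularity of the Riemann-Liouville integral *)

Section RiemannLiouvilleRegularity.
Context {R : realType}.
Implicit Types (a b e p q s t tau x y C M : R) (f g G : R -> R).
Local Notation mu := (@lebesgue_measure R).

Lemma near_oo x y s (P : R -> Prop) : x < s < y ->
  (forall z, x < z < y -> P z) -> \forall z \near s, P z.
Proof.
move=> xsy h; have /near_in_itvoo : s \in `]x, y[ by rewrite in_itv.
by apply: filterS => z; rewrite in_itv /= => /h.
Qed.

Lemma continuous_for_eq_oo f g x y s : x < s < y ->
  (forall z, x < z < y -> f z = g z) ->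
  {for s, continuous f} -> {for s, continuous g}.
Proof.
move=> xsy fg cf; rewrite /prop_for /continuous_at -fg //.
by apply: cvg_trans cf; apply: near_eq_cvg; exact: near_oo xsy fg.
Qed.

Lemma is_derive_eq_oo f g x y s (d : R) : x < s < y ->
  (forall z, x < z < y -> f z = g z) -> is_derive s 1 f d -> is_derive s 1 g d.
Proof. by move=> xsy fg; apply: near_eq_is_derive; exact: near_oo xsy fg. Qed.

Lemma is_derive_inj f x (c d : R) :
  is_derive x 1 f c -> is_derive x 1 f d -> c = d.
Proof. by move=> [_ <-] [_ <-]. Qed.

Lemma is_derive_continuous f x (d : R) :
  is_derive x 1 f d -> {for x, continuous f}.
Proof.
move=> [df _]; apply: differentiable_continuous.
exact/derivable1_diffP.
Qed.

Lemma is_derive_eq_cst f g x y (df : R -> R) : x <= y ->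
  (forall z, x <= z <= y -> is_derive z 1 f (df z)) ->
  (forall z, x <= z <= y -> is_derive z 1 g (df z)) ->
  f x = g x -> f y = g y.
Proof.
rewrite le_eqVlt => /predU1P[->//|xy] dfx dgx fgx.
have dh z : x <= z <= y -> is_derive z 1 (fun z => f z - g z) ((cst 0 : R -> R) z).
  move=> zxy; rewrite /cst -[0](subrr (df z)).
  exact: is_deriveB (dfx z zxy) (dgx z zxy).
have [||c _] := @MVT _ (fun z => f z - g z) (cst 0) x y xy.
- by move=> z; rewrite in_itv /= => /andP[xz zy]; apply: dh; rewrite !ltW.
- apply: continuous_in_subspaceT => z; rewrite inE /= in_itv /= => /dh.
  exact: is_derive_continuous.
rewrite fgx subrr subr0 /cst mul0r => /eqP.
by rewrite subr_eq0 => /eqP.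
Qed.

Lemma RL1E f s : RL 1 f s = \int[mu]_(r in `]0, s[) f r.
Proof.
by apply: eq_Rintegral => r _; rewrite subrr powRr0 mulr1.
Qed.

Lemma tame_integrable p M f s : 0 <= p < 1 -> tame p M f -> s < M ->
  mu.-integrable `]0, s[ (EFin \o f).
Proof.
move=> hp tf sM.
have h1 : 0 < (1 : R) <= 1 by rewrite ltr01 lexx.
have := tame_RL_integrable h1 hp tf sM.
rewrite (_ : (fun r => _) = EFin \o f) //; apply/funext => r /=.
by rewrite subrr powRr0 mulr1.
Qed.

Lemma RL1_derive p M f s : 0 <= p < 1 -> tame p M f -> 0 < s < M ->
  is_derive s 1 (RL 1 f) (f s).
Proof.
move=> hp tf /andP[s0 sM].
pose u := (s + M) / 2; have [su uM] : s < u /\ u < M by rewrite /u; lra.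
have iu : mu.-integrable `]0, u] (EFin \o f).
  apply: integrableS (tame_integrable hp tf (_ : (u + M) / 2 < M)) => //.
    by move=> r /=; rewrite !in_itv /= => /andP[-> ru] /=; move: uM ru; lra.
  by move: uM; lra.
have cf : {for s, continuous f} by apply: (proj1 tf); rewrite s0.
have /= [] := continuous_FTC1 su iu _ cf; first by rewrite lte_fin.
move=> dF F'.
apply: (@is_derive_eq_oo (fun x => \int[mu]_(t in `]0, x]) f t) _ 0 M).
- by rewrite s0.
- move=> z /andP[z0 zM]; rewrite RL1E Rintegral_itv_bndo_bndc //.
  exact: tame_integrable tf zM.
- by split; [exact: dF|rewrite -derive1E; exact: F'].
Qed.

Section Continuity.
Variables (a p M : R) (f : R -> R).
Hypotheses (ha : 0 < a <= 1) (hp : 0 <= p < 1) (tf : tame p M f).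

Let F x (u : R) : R := f (u * x) * (1 - u) `^ (a - 1) * x `^ a.

(** On the unit interval the singularity of the kernel is at a fixed place,
    so that the integrand depends continuously on the end point [s]. *)
Let RL_unit s : 0 < s < M -> RL a f s = \int[mu]_(u in `]0, 1[) F s u.
Proof.
move=> /andP[s0 sM]; rewrite /RL Rintegral_substitution_affine //; last first.
  move=> y /andP[y0 ys]; apply: continuousM.
    by apply: (proj1 tf); rewrite y0 (lt_trans ys).
  apply: (@continuous_comp _ _ _ (fun u : R => s - u) (@powR R ^~ (a - 1))).
    by apply: continuousB; [exact: cvg_cst|exact: cvg_id].
  by apply: continuous_powR; rewrite subr_gt0.
apply: eq_Rintegral => u; rewrite inE /= in_itv /= => /andP[u0 u1].
rewrite /F subr0 add0r -{2}[s]mul1r -mulrBl powRM ?subr_ge0 ?ltW //.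
by rewrite -[in RHS](mulr_powRB1 (ltW s0)) ?(proj1 (andP ha)) //; ring.
Qed.

Lemma RL_continuous s : 0 < s < M -> {for s, continuous (RL a f)}.
Proof.
move=> /andP[s0 sM]; have a0 : 0 < a by case/andP: ha.
pose x0 := s / 2; pose x1 := (s + M) / 2.
have [x00 [x0s [sx1 x1M]]] : 0 < x0 /\ x0 < s /\ s < x1 /\ x1 < M.
  by rewrite /x0 /x1; lra.
have [C C0 fC] := tame_bound (proj1 (andP hp)) tf x1M.
pose K := C * x0 `^ (- p) * x1 `^ a.
have K0 : 0 <= K by rewrite /K !mulr_ge0 ?powR_ge0.
pose g (u : R) := K * (u `^ (1 - p - 1) * (1 - u) `^ (a - 1)).
have hp1 : 0 < 1 - p <= 1 by move: hp; lra.
have ig : mu.-integrable `]0, 1[ (EFin \o g).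
  exact: (@integrableZl _ _ _ mu _ (measurable_itv `]0, 1[) K _ (integrable_euler_kernel 1 ha hp1)).
have Fg x (u : R) : x0 < x < x1 -> 0 < u < 1 -> `|F x u| <= g u.
  move=> /andP[x0x xx1] /andP[u0 u1].
  have xp : 0 < x by exact: lt_trans x0x.
  rewrite /F /g !normrM ![`|_ `^ _|]ger0_norm ?powR_ge0 //.
  rewrite (_ : 1 - p - 1 = - p); last by ring.
  have h1 : `|f (u * x)| <= C * x0 `^ (- p) * u `^ (- p).
    have ux : 0 < u * x <= x1 by rewrite mulr_gt0 //=; nra.
    apply: (le_trans (fC _ ux)); rewrite (powRM _ (ltW u0) (ltW xp)) -mulrA ler_wpM2l //.
    rewrite mulrC ler_wpM2r ?powR_ge0 //; apply: le_powR_neg => //.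
      by move: hp; lra.
    exact: ltW.
  have h2 : x `^ a <= x1 `^ a by apply: ge0_ler_powR; rewrite ?nnegrE ?ltW // (lt_trans xp).
  rewrite /K (_ : C * _ * _ * _ = C * x0 `^ (- p) * u `^ (- p) *
     (1 - u) `^ (a - 1) * x1 `^ a); last by ring.
  by apply: ler_pM => //; rewrite ?mulr_ge0 ?powR_ge0 // ler_wpM2r ?powR_ge0.
have cfu x (u : R) : x0 < x < x1 -> 0 < u < 1 -> {for u * x, continuous f}.
  move=> /andP[x0x xx1] /andP[u0 u1]; apply: (proj1 tf).
  have xp : 0 < x by exact: lt_trans x0x.
  by rewrite mulr_gt0 //=; nra.
have iF x : `]x0, x1[%classic x -> mu.-integrable `]0, 1[ (EFin \o F x).
  rewrite /= in_itv /= => xI; apply: le_integrable ig => //.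
    apply/measurable_EFinP; apply: measurable_funM => //.
    apply: measurable_funM; last by apply: measurable_funTS; exact: measurable_kernel.
    apply: open_continuous_measurable_fun => // u; rewrite inE /= in_itv /= => uI.
    apply: (@continuous_comp _ _ _ (fun u : R => u * x) f); last exact: cfu.
    by apply: continuousM; [exact: cvg_id|exact: cvg_cst].
  move=> u; rewrite /= in_itv /= => uI; rewrite lee_fin.
  by apply: (le_trans (Fg _ _ xI uI)); exact: ler_norm.
have cF : {in `]x0, x1[%classic, continuous (fun x => \int[mu]_(u in `]0, 1[) F x u)}.
  have cFae : {ae mu, forall u, `]0, 1[%classic u ->
      {in `]x0, x1[%classic, continuous (F ^~ u)}}.
    apply: aeW => u; rewrite /= in_itv /= => uI x; rewrite inE /= in_itv /= => xI.
    suff : {for x, continuous (fun x : R =>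
      f (u * x) * (1 - u) `^ (a - 1) * x `^ a)} by [].
    apply: continuousM; last by apply: continuous_powR; move: xI x00; lra.
    apply: continuousM; last exact: cvg_cst.
    apply: (@continuous_comp _ _ _ (fun x : R => u * x) f); last exact: cfu.
    by apply: continuousM; [exact: cvg_cst|exact: cvg_id].
  have Fae x : `]x0, x1[%classic x ->
      {ae mu, forall u, `]0, 1[%classic u -> `|F x u| <= g u}.
    rewrite /= in_itv /= => xI.
    by apply: aeW => u; rewrite /= in_itv /= => uI; exact: Fg.
  have := @continuity_under_integral _ _ _ mu F _ (measurable_itv `]0, 1[) x0 x1 iF cFae g ig Fae.
  exact.
apply: (@continuous_for_eq_oo (fun x => \int[mu]_(u in `]0, 1[) F x u) _ x0 x1).
- by rewrite x0s.
- by move=> z /andP[z0 z1]; rewrite RL_unit // (lt_trans x00) // (lt_trans z1).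
- by apply: cF; rewrite inE /= in_itv /= x0s.
Qed.

Lemma tame_RL : 0 < M -> tame p M (RL a f).
Proof.
move=> M0; split; first by move=> s; exact: RL_continuous.
have M2 : M / 2 < M by lra.
have [C C0 fC] := tame_bound (proj1 (andP hp)) tf M2.
exists (Num.min (M / 2) 1), (C * euler_beta (1 - p) a); split.
  by rewrite lt_min ltr01 andbT; lra.
move=> s /andP[s0]; rewrite lt_min => /andP[sM s1].
have hp1 : 0 < 1 - p <= 1 by move: hp; lra.
apply: (le_trans (@RL_bound _ a p s C f ha hp _ _ s0)).
- by apply: tame_measurable tf; move: sM; lra.
- by move=> r /andP[r0 rs]; apply: fC; rewrite r0 ltW // (lt_trans rs).
apply: ler_wpM2l.
  by rewrite mulr_ge0 // (le_trans ler01) // euler_beta_ge1.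
apply: ger_powR; first by rewrite s0 ltW.
by case/andP: ha => a0 _; move: a0; lra.
Qed.

End Continuity.

(** Applying the operator of the complementary order turns [RL a f] into a
    multiple of the primitive of [f]. *)
Lemma RL_injective a p M f : 0 < a < 1 -> 0 <= p < 1 -> tame p M f ->
  (forall s, 0 < s < M -> RL a f s = 0) -> forall s, 0 < s < M -> f s = 0.
Proof.
move=> /andP[a0 a1] hp tf f0 s /andP[s0 sM].
have b0 : 0 < 1 - a by rewrite subr_gt0.
have ab1 : 1 - a + a <= 1 by lra.
have I0 z : 0 < z < M -> RL 1 f z = 0.
  move=> /andP[z0 zM].
  have := RL_semigroup b0 a0 ab1 hp tf zM.
  rewrite (@eq_RL _ (1 - a) _ (fun=> 0 * 1)) => [|r /andP[r0 rz]]; last first.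
    by rewrite f0 ?mul0r // r0 (lt_trans rz).
  have hb : 0 < 1 - a <= 1 by lra.
  rewrite (RLZ 0 hb hp (tame_cst M 1 (proj1 (andP hp))) zM) mul0r subrK.
  move/esym/eqP; rewrite mulf_eq0 => /orP[/eqP B0|/eqP//].
  exfalso; have : 1 <= euler_beta a (1 - a) by apply: euler_beta_ge1; lra.
  by rewrite B0 ler10.
apply: (@is_derive_inj (RL 1 f) s); first by apply: RL1_derive tf _; rewrite // s0.
apply: (@is_derive_eq_oo (cst 0) _ 0 M); first by rewrite s0.
by move=> z /I0 ->.
Qed.

(** While [x] stays away from [0, eta], the kernel and its derivative in [x]
    are bounded uniformly in [r]. *)
Lemma remote_integral_derive e eta g s : 0 < eta < s ->
  mu.-integrable `]0, eta[ (EFin \o g) ->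
  is_derive s 1 (fun x => \int[mu]_(r in `]0, eta[) (g r * (x - r) `^ e))
    (e * \int[mu]_(r in `]0, eta[) (g r * (s - r) `^ (e - 1))).
Proof.
move=> /andP[eta0 etas] ig.
pose x0 := (eta + s) / 2; pose x1 := s + 1.
have [ex0 [x0s sx1]] : eta < x0 /\ x0 < s /\ s < x1 by rewrite /x0 /x1; lra.
pose K d := (x0 - eta) `^ d + x1 `^ d.
have powK d x (r : R) : x0 < x < x1 -> 0 < r < eta -> (x - r) `^ d <= K d.
  move=> xI rI; have [d0|d0] := leP 0 d.
    apply: (@le_trans _ _ (x1 `^ d)); last by rewrite lerDr powR_ge0.
    by apply: ge0_ler_powR; rewrite // ?nnegrE; lra.
  apply: (@le_trans _ _ ((x0 - eta) `^ d)); last by rewrite lerDl powR_ge0.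
  by apply: le_powR_neg; lra.
have ik d x : x0 < x < x1 ->
    mu.-integrable `]0, eta[ (fun r => (g r * (x - r) `^ d)%:E).
  move=> xI.
  have iK := @integrableZl _ _ _ mu _ (measurable_itv `]0, eta[) (K d) _ (integrable_abse ig).
  apply: le_integrable iK => //.
    apply/measurable_EFinP; apply: measurable_funM.
      by apply/measurable_EFinP; case/integrableP: ig.
    by apply: measurable_funTS; exact: measurable_kernel.
  move=> r; rewrite /= in_itv /= => rI; rewrite lee_fin normrM mulrC.
  rewrite [`|_ `^ _|]ger0_norm ?powR_ge0 //.
  apply: le_trans (ler_norm _); apply: ler_wpM2r => //; exact: powK.
have dk x (r : R) : x0 < x < x1 -> 0 < r < eta ->
    is_derive x 1 (fun x => g r * (x - r) `^ e) (e * (g r * (x - r) `^ (e - 1))).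
  move=> xI rI.
  have dB : is_derive x 1 (fun x : R => x - r) 1.
    rewrite -[1 in X in is_derive _ _ _ X]subr0.
    exact: (is_deriveB (is_derive_id x 1) (is_derive_cst r x 1)).
  have dP : is_derive (x - r) 1 (@powR R ^~ e) (e * (x - r) `^ (e - 1)).
    by apply: is_derive1_powR; lra.
  have dC := @is_derive1_comp _ (@powR R ^~ e) (fun x : R => x - r) x _ _ dP dB.
  have := is_deriveZ (g r) dC.
  by move=> /is_derive_eq; apply; rewrite /GRing.scale /= mulr1 mulrCA.
pose f x (r : R) : R := g r * (x - r) `^ e.
pose G (r : R) : R := `|e| * K (e - 1) * `|g r|.
have Is : `]x0, x1[%classic s by rewrite /= in_itv /= x0s.
have intf x : `]x0, x1[%classic x -> mu.-integrable `]0, eta[ (EFin \o f x).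
  by rewrite /= in_itv /= => /(ik e).
have derf x (r : R) : `]x0, x1[%classic x -> `]0, eta[%classic r ->
    derivable (f ^~ r) x 1.
  by rewrite /= !in_itv /= => xI rI; have [] := dk _ _ xI rI.
have K0 d : 0 <= K d by rewrite addr_ge0 ?powR_ge0.
have G0 r : 0 <= G r by rewrite !mulr_ge0.
have iG : mu.-integrable `]0, eta[ (EFin \o G).
  exact: (@integrableZl _ _ _ mu _ (measurable_itv `]0, eta[) (`|e| * K (e - 1)) _ (integrable_abse ig)).
have f'E x (r : R) : x0 < x < x1 -> 0 < r < eta ->
    partial1of2 f x r = e * (g r * (x - r) `^ (e - 1)).
  by move=> xI rI; rewrite partial1of2E; have [] := dk _ _ xI rI.
have fG x (r : R) : `]x0, x1[%classic x -> `]0, eta[%classic r ->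
    `|partial1of2 f x r| <= G r.
  rewrite /= !in_itv /= => xI rI; rewrite f'E // /G !normrM -mulrA.
  rewrite ler_wpM2l // mulrC ler_wpM2r // ger0_norm ?powR_ge0 //.
  exact: powK.
have mI := measurable_itv (`]0, eta[ : interval R).
have dF := @derivable_under_integral _ _ _ mu f _ mI s x0 x1 Is intf derf G G0 iG fG.
have F' := @differentiation_under_integral _ _ _ mu f _ mI s x0 x1 Is intf derf G G0 iG fG.
split; first exact: dF.
rewrite -derive1E F'.
rewrite -RintegralZl //; last by apply: ik; rewrite x0s.
apply: eq_Rintegral => r; rewrite inE /= in_itv /= => rI.
by rewrite f'E // x0s.
Qed.

End RiemannLiouvilleRegularity.

(** * Extension of a solution of Abel's equation *)

Section AbelExtension.
Context {R : realType}.
Implicit Types (a b e p q s t x y C M N : R) (f g : R -> R).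
Local Notation mu := (@lebesgue_measure R).

(** By homogeneity. *)
Lemma RL_powR a q s : 0 < a <= 1 -> 0 <= q -> 0 < s ->
  RL a (@powR R ^~ q) s = RL a (@powR R ^~ q) 1 * s `^ (a + q).
Proof.
move=> ha q0 s0; have a0 : 0 < a by case/andP: ha.
have ip : mu.-integrable `]0, 1[ (fun u => (u `^ q * (1 - u) `^ (a - 1))%:E).
  have h0 : 0 <= (0 : R) < 1 by rewrite lexx ltr01.
  have h2 : (1 : R) < 2 by rewrite ltr1n.
  exact: (tame_RL_integrable ha h0 (tame_powR 2 (lexx 0) q0) h2).
rewrite /RL Rintegral_substitution_affine //; last first.
  move=> y /andP[y0 ys]; apply: continuousM; first exact: continuous_powR.
  apply: (@continuous_comp _ _ _ (fun u : R => s - u) (@powR R ^~ (a - 1))).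
    by apply: continuousB; [exact: cvg_cst|exact: cvg_id].
  by apply: continuous_powR; rewrite subr_gt0.
rewrite -RintegralZr //; apply: eq_Rintegral => u.
rewrite inE /= in_itv /= => /andP[u0 u1].
have u10 : 0 <= 1 - u by rewrite subr_ge0 ltW.
rewrite subr0 add0r -{2}[s]mul1r -mulrBl !powRM ?(ltW s0) ?(ltW u0) //.
have nz : (a + q == 0) ==> (s != 0) by apply/implyP => _; rewrite gt_eqF.
rewrite (powRD nz) -(mulr_powRB1 (ltW s0) a0).
ring.
Qed.

Lemma RL_powR_derive a q s : 0 < a <= 1 -> 0 <= q -> 0 < s ->
  is_derive s 1 (RL a (@powR R ^~ q))
    (RL a (@powR R ^~ q) 1 * ((a + q) * s `^ (a + q - 1))).
Proof.
move=> ha q0 s0; have s2 : s < s + 1 by rewrite ltrDl.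
apply: (@is_derive_eq_oo _
  (fun s => RL a (@powR R ^~ q) 1 * s `^ (a + q)) _ 0 (s + 1)).
- by rewrite s0.
- by move=> z /andP[z0 _]; rewrite (RL_powR ha q0 z0).
- exact: (is_deriveZ (RL a (@powR R ^~ q) 1) (is_derive1_powR (a + q) s0)).
Qed.

Lemma RL_support a f eta s : eta <= s -> (forall r, eta <= r -> f r = 0) ->
  RL a f s = \int[mu]_(r in `]0, eta[) (f r * (s - r) `^ (a - 1)).
Proof.
move=> es f0; rewrite /RL Rintegral_mkcond [RHS]Rintegral_mkcond.
apply: eq_Rintegral => r _; rewrite !patchE.
case: ifPn; rewrite ?inE ?notin_setE /= in_itv /= => h1;
  case: ifPn; rewrite ?inE ?notin_setE /= in_itv /= => h2 //.
- by rewrite f0 ?mul0r //; move: h1 h2; case: leP => // ? ? /negP; lra.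
- by move: h1 h2; lra.
Qed.

Section Extension.
Variables (a p q M eta c p0 : R) (z : R -> R).
Hypotheses (a01 : 0 < a < 1) (hp : 0 <= p < 1) (q0 : 0 <= q).
Hypotheses (eta0 : 0 < eta) (etaM : eta < M) (tz : tame p M z).
Hypothesis zE : forall s, eta <= s < M -> RL (1 - a) z s = c * s `^ q + p0.

Let b := 1 - a.
Let ha : 0 < a <= 1. Proof. by move: a01; lra. Qed.
Let hb : 0 < b <= 1. Proof. by rewrite /b; move: a01; lra. Qed.
Let M0 : 0 < M. Proof. exact: lt_trans etaM. Qed.

(* [Q] is the right-hand side of Abel's equation: known up to [M], and equal to
   [tail] from [eta] on; [w] is their difference, supported in [0, eta] *)
Let tail r : R := c * r `^ q + p0.
Let w r : R := if r < eta then RL b z r - tail r else 0.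
Let Q r : R := tail r + w r.

Let Qin s : 0 < s < M -> Q s = RL b z s.
Proof.
move=> /andP[s0 sM]; rewrite /Q /w; case: ltP => es; first by rewrite addrC subrK.
by rewrite zE ?es // addr0.
Qed.

Let Qout s : eta <= s -> Q s = tail s.
Proof. by move=> es; rewrite /Q /w ltNge es /= addr0. Qed.

Let tame_tail N : tame p N tail.
Proof.
have p0' := proj1 (andP hp).
by apply: tameD; [apply: tameZ; exact: tame_powR|exact: tame_cst].
Qed.

Let tame_Q N : tame p N Q.
Proof.
have tb := tame_RL hb hp tz M0.
split=> [s /andP[s0 sN]|].
  have [sM|Ms] := ltP s M.
    apply: (@continuous_for_eq_oo _ (RL b z) _ 0 M); first by rewrite s0.
      by move=> r /Qin.
    by apply: (proj1 tb); rewrite s0.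
  have es : eta < s by exact: lt_le_trans Ms.
  apply: (@continuous_for_eq_oo _ tail _ eta (s + 1)).
  - by rewrite es ltrDl ltr01.
  - by move=> r /andP[er _]; rewrite Qout // ltW.
  - by apply: (proj1 (tame_tail (s + 1))); rewrite s0 ltrDl ltr01.
have [_ [e [C [e0 fC]]]] := tb.
exists (Num.min e M), C; split; first by rewrite lt_min e0.
move=> r /andP[r0]; rewrite lt_min => /andP[re rM].
by rewrite Qin ?r0 //; apply: fC; rewrite r0.
Qed.

Let tame_w N : tame p N w.
Proof.
have -> : w = (fun r => Q r - tail r).
  by apply/funext => r; rewrite /Q addrC addKr.
exact: tameB.
Qed.

Let B := euler_beta b a.
Let B0 : B != 0.
Proof.
have : 1 <= B by exact: euler_beta_ge1.
by move=> B1; rewrite gt_eqF // (lt_le_trans ltr01).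
Qed.

Let L s := RL a Q s.

Let L_in s : 0 < s < M -> L s = B * RL 1 z s.
Proof.
move=> /andP[s0 sM]; rewrite /L (@eq_RL _ a _ (RL b z)); last first.
  by move=> r /andP[r0 rs]; rewrite Qin // r0 (lt_trans rs).
have ba1 : a + b <= 1 by rewrite /b; lra.
rewrite (RL_semigroup (proj1 (andP ha)) (proj1 (andP hb)) ba1 hp tz sM).
by rewrite (_ : a + b = 1) // /b addrC subrK.
Qed.

Let L_derive_in s : 0 < s < M -> is_derive s 1 L (B * z s).
Proof.
move=> sM; apply: (@is_derive_eq_oo _ (fun s => B * RL 1 z s) _ 0 M) => //.
  by move=> r /L_in ->.
exact: (is_deriveZ B (RL1_derive hp tz sM)).
Qed.

Let remote e s : R := \int[mu]_(r in `]0, eta[) (w r * (s - r) `^ e).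

(* the derivative of [L] after [eta], in closed form *)
Let D s : R :=
  c * (RL a (@powR R ^~ q) 1 * ((a + q) * s `^ (a + q - 1))) +
  p0 * (RL a (@powR R ^~ 0) 1 * ((a + 0) * s `^ (a + 0 - 1))) +
  (a - 1) * remote (a - 1 - 1) s.

Let iw : mu.-integrable `]0, eta[ (EFin \o w).
Proof. exact: (tame_integrable hp (tame_w M) etaM). Qed.

Let remote_derive e s : eta < s -> is_derive s 1 (remote e) (e * remote (e - 1) s).
Proof.
by move=> es; apply: remote_integral_derive => //; rewrite eta0.
Qed.

Let L_derive_out s : eta < s -> is_derive s 1 L (D s).
Proof.
move=> es; have s0 : 0 < s by exact: lt_trans es.
have p0' := proj1 (andP hp).
have tp r := tame_powR (s + 1) p0' r.
apply: (@is_derive_eq_oo _ (fun s => c * RL a (@powR R ^~ q) s +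
   p0 * RL a (@powR R ^~ 0) s + remote (a - 1) s) _ eta (s + 1)).
- by rewrite es ltrDl ltr01.
- move=> r /andP[er rs]; rewrite /L.
  have QE x : 0 < x < r -> Q x = c * x `^ q + p0 * x `^ 0 + w x.
    by rewrite /Q /tail powRr0 mulr1.
  rewrite (eq_RL a QE).
  rewrite (RLD ha hp (tameD (tameZ c (tp q q0)) (tameZ p0 (tp 0 (lexx 0)))) (tame_w _) rs).
  rewrite (RLD ha hp (tameZ c (tp q q0)) (tameZ p0 (tp 0 (lexx 0))) rs).
  rewrite (RLZ c ha hp (tp q q0) rs) (RLZ p0 ha hp (tp 0 (lexx 0)) rs).
  congr (_ + _); apply/esym; apply: RL_support; first exact: ltW.
  by move=> x ex; rewrite /w ltNge ex.
- apply: is_deriveD; last exact: remote_derive.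
  apply: is_deriveD.
    exact: (is_deriveZ c (RL_powR_derive ha q0 s0)).
  exact: (is_deriveZ p0 (RL_powR_derive ha (lexx 0) s0)).
Qed.

Let D_continuous s : eta < s -> {for s, continuous D}.
Proof.
move=> es; have s0 : 0 < s by exact: lt_trans es.
have cp e : {for s, continuous (@powR R ^~ e)} by exact: continuous_powR.
have ck (k : R) : {for s, continuous (fun _ : R => k)} by exact: cvg_cst.
apply: continuousD; last first.
  apply: continuousM; first exact: ck.
  exact: is_derive_continuous (remote_derive _ es).
by apply: continuousD; repeat (apply: continuousM; first exact: ck); exact: cp.
Qed.

Let zt s : R := if s < M then z s else B^-1 * D s.

Let zt_out s : eta < s -> B * zt s = D s.
Proof.
move=> es; rewrite /zt; case: ltP => sM; last by rewrite mulrA mulfV // mul1r.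
have s0M : 0 < s < M by rewrite sM (lt_trans eta0).
exact: is_derive_inj (L_derive_in s0M) (L_derive_out es).
Qed.

Let zt_in s : 0 < s < M -> zt s = z s.
Proof. by rewrite /zt => /andP[_ ->]. Qed.

Let tame_zt N : tame p N zt.
Proof.
have [cz [e [C [e0 zC]]]] := tz.
split=> [s /andP[s0 sN]|].
  have [sM|Ms] := ltP s M.
    apply: (@continuous_for_eq_oo _ z _ 0 M); first by rewrite s0.
      by move=> r /zt_in.
    by apply: cz; rewrite s0.
  have es : eta < s by exact: lt_le_trans Ms.
  apply: (@continuous_for_eq_oo _ (fun s => B^-1 * D s) _ eta (s + 1)).
  - by rewrite es ltrDl ltr01.
  - by move=> r /andP[er _]; rewrite -zt_out // mulrA mulVf // mul1r.
  - by apply: continuousM; [exact: cvg_cst|exact: D_continuous].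
exists (Num.min e M), C; split; first by rewrite lt_min e0.
move=> r /andP[r0]; rewrite lt_min => /andP[re rM].
by rewrite zt_in ?r0 //; apply: zC; rewrite r0.
Qed.

Let primitive_zt s : 0 < s -> B * RL 1 zt s = L s.
Proof.
move=> s0.
have early r : 0 < r < M -> B * RL 1 zt r = L r.
  move=> /andP[r0 rM]; rewrite L_in ?r0 //; congr (_ * _).
  by apply: eq_RL => y /andP[y0 yr]; rewrite zt_in // y0 (lt_trans yr).
have [sM|Ms] := ltP s M; first by apply: early; rewrite s0.
pose x := (eta + M) / 2; have [ex xM] : eta < x /\ x < M by move: etaM; rewrite /x; lra.
have x0 : 0 < x by exact: lt_trans ex.
apply: (@is_derive_eq_cst _ (fun s => B * RL 1 zt s) L x s (fun r => B * zt r)).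
- by rewrite (le_trans (ltW xM)).
- move=> r /andP[xr rs].
  have rI : 0 < r < s + 1 by rewrite (lt_le_trans x0) //= (le_lt_trans rs) // ltrDl.
  exact: (is_deriveZ B (RL1_derive hp (tame_zt (s + 1)) rI)).
- move=> r /andP[xr rs]; have er : eta < r by exact: lt_le_trans xr.
  by rewrite zt_out //; exact: L_derive_out.
- by apply: early; rewrite x0.
Qed.

(** After [eta] the right-hand side of Abel's equation is explicit, and so is
    [RL a] of it, up to an integral over [0, eta]; its derivative provides the
    values of the extension. *)
Lemma abel_extension : exists zt : R -> R,
  [/\ forall N, tame p N zt, forall s, 0 < s < M -> zt s = z s
    & forall s, eta <= s -> RL (1 - a) zt s = c * s `^ q + p0].
Proof.
exists zt; split=> // s es; rewrite -/(tail s) -(Qout es).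
have s0 : 0 < s by exact: lt_le_trans es.
have sN : s < s + 1 by rewrite ltrDl.
have N0 : 0 < s + 1 by exact: lt_trans sN.
have tbz := tame_RL hb hp (tame_zt (s + 1)) N0.
apply/eqP; rewrite -subr_eq0; apply/eqP.
apply: (@RL_injective _ a p (s + 1) (fun r => RL b zt r - Q r)) => //.
- exact: tameB.
- move=> r /andP[r0 rN]; rewrite (RLB ha hp tbz (tame_Q _) rN).
  have ba1 : a + b <= 1 by rewrite /b; lra.
  rewrite (RL_semigroup (proj1 (andP ha)) (proj1 (andP hb)) ba1 hp (tame_zt _) rN).
  rewrite (_ : a + b = 1); last by rewrite /b addrC subrK.
  by rewrite primitive_zt // subrr.
- by rewrite s0.
Qed.

End Extension.

End AbelExtension.

(** * The Volterra equation past the end point *)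

Section Volterra.
Context {R : realType}.
Implicit Types (a b e p q s t x y C M N d S : R) (f g v w : R -> R).
Local Notation mu := (@lebesgue_measure R).

Lemma le0_geometric (x K : R) : 0 <= K -> (forall n, x <= K / 2 ^+ n) -> x <= 0.
Proof.
move=> K0 xK; rewrite leNgt; apply/negP => x0.
have [n nK] : exists n : nat, K / x < n%:R.
  by exists (Num.trunc (K / x)).+1; exact: truncnS_gt.
have := xK n; rewrite ler_pdivlMr ?exprn_gt0 // leNgt => /negP; apply.
rewrite -ltr_pdivrMl // mulrC; apply: (lt_trans nK).
rewrite -natrX ltr_nat; exact: ltn_expl.
Qed.

Variables (a p M eta M' A k : R) (Phi : R -> R -> R) (chi zt X : R -> R).
Hypotheses (ha : 0 < a <= 1) (hp : 0 <= p < 1).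
Hypotheses (eta0 : 0 < eta) (etaM : eta < M) (MM' : M < M').
Hypothesis Phi_cont : forall z : R * R, 0 < z.1 ->
  {for z, continuous (fun z : R * R => Phi z.1 z.2)}.
Hypothesis Phi_lip : forall s x y, 0 < s -> `|Phi s x - Phi s y| <= A * `|x - y|.
Hypotheses (A0 : 0 <= A) (k0 : 0 <= k).
Hypothesis chi_cont : continuous chi.
Hypothesis chi01 : forall s, 0 <= chi s <= 1.
Hypothesis chi_0 : forall s, s <= eta / 2 -> chi s = 0.
Hypothesis zt_tame : forall N, tame p N zt.
Hypothesis X_tame : tame p M X.

Definition cutoff_forcing v r : R := chi r * Phi r (v r).
Local Notation H := cutoff_forcing.

Hypothesis X_eq : forall s, 0 < s < M -> X s = zt s + k * RL a (H X) s.
Hypothesis small : k * A * euler_beta 1 a * (M' - eta) `^ a <= 2^-1.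

Let T v s : R := zt s + k * RL a (H v) s.

Lemma continuous_forcing v s : 0 < s -> {for s, continuous v} ->
  {for s, continuous (H v)}.
Proof.
move=> s0 cv; apply: continuousM; first exact: chi_cont.
apply: (@continuous2_cvg _ _ _ _ _ _ (fun r => r) v Phi s (v s)).
- exact: (Phi_cont (z := (s, v s)) s0).
- exact: cvg_id.
- exact: cv.
Qed.

Lemma tame_forcing v N : (forall s, 0 < s < N -> {for s, continuous v}) ->
  tame p N (H v).
Proof.
move=> cv; apply: (@bounded_tame _ p N _ (eta / 2) 0).
- by case/andP: hp.
- by rewrite divr_gt0.
- move=> s sN; apply: continuous_forcing; last exact: cv.
  by case/andP: sN.
- by move=> r /andP[r0 re]; rewrite /H chi_0 ?mul0r ?normr0 // ltW.
Qed.

Let T_continuous v N : 0 < N -> (forall s, 0 < s < N -> {for s, continuous v}) ->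
  forall s, 0 < s < N -> {for s, continuous (T v)}.
Proof.
move=> N0 cv s sN; apply: continuousD; first by apply: (proj1 (zt_tame N)).
apply: continuousM; first exact: cvg_cst.
by apply: (RL_continuous ha hp (tame_forcing cv)).
Qed.

(** On functions that agree up to [eta], the integral operator only sees the
    short interval from [eta] on, and is a contraction for the sup norm. *)
Let contraction v w S d : S <= M' ->
  (forall s, 0 < s < S -> {for s, continuous v}) ->
  (forall s, 0 < s < S -> {for s, continuous w}) ->
  (forall s, 0 < s <= eta -> v s = w s) ->
  (forall s, 0 < s < S -> `|v s - w s| <= d) ->
  forall s, 0 < s < S -> `|T v s - T w s| <= d / 2.
Proof.
move=> SM' cv cw vw vwd s /andP[s0 sS].
have d0 : 0 <= d by apply: le_trans (vwd s _); rewrite ?s0.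
have tv := tame_forcing cv; have tw := tame_forcing cw.
have -> : T v s - T w s = k * (RL a (H v) s - RL a (H w) s).
  by rewrite /T mulrBr opprD addrACA subrr add0r.
rewrite normrM (ger0_norm k0) -(RLB ha hp tv tw sS).
have Hvw r : 0 < r <= eta -> H v r - H w r = 0.
  by move=> rI; rewrite /H vw // subrr.
have [se|es] := leP s eta.
  rewrite (@eq_RL _ a _ (fun=> 0 * 1)) => [|r /andP[r0 rs]]; last first.
    by rewrite Hvw ?mul0r // r0 (le_trans (ltW rs)).
  rewrite (RLZ 0 ha hp (tame_cst S 1 (proj1 (andP hp))) sS) mul0r normr0 mulr0.
  by rewrite divr_ge0.
have h1 : 0 < (1 : R) <= 1 by rewrite ltr01 lexx.
have ek := integral_euler_kernel ha h1 es.
have kE r : (r - eta) `^ (1 - 1) * (s - r) `^ (a - 1) = (s - r) `^ (a - 1).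
  by rewrite subrr powRr0 mul1r.
have ik : mu.-integrable `]eta, s[ (fun r => ((s - r) `^ (a - 1))%:E).
  apply/integrableP; split.
    by apply/measurable_EFinP; apply: measurable_funTS; exact: measurable_kernel.
  under eq_integral do rewrite gee0_abs ?lee_fin ?powR_ge0 // -kE.
  by rewrite ek ltry.
have ki : \int[mu]_(r in `]eta, s[) (s - r) `^ (a - 1) = euler_beta 1 a * (s - eta) `^ a.
  under eq_Rintegral do rewrite -kE.
  by rewrite /Rintegral ek /= addrK.
have RLE : RL a (fun r => H v r - H w r) s =
    \int[mu]_(r in `]eta, s[) ((H v r - H w r) * (s - r) `^ (a - 1)).
  rewrite (_ : `]eta, s[%classic = `]0, s[%classic `&` `]eta, s[%classic); last first.
    by apply/seteqP; split=> r /=; rewrite !in_itv /=; move: eta0; lra.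
  rewrite Rintegral_mkcondr; apply: eq_Rintegral => r.
  rewrite inE /= in_itv /= => /andP[r0 rs]; rewrite patchE.
  case: ifPn => //; rewrite notin_setE /= in_itv /= rs andbT => /negP.
  by rewrite -leNgt => re; rewrite Hvw ?mul0r // r0.
have iRL : mu.-integrable `]eta, s[
    (EFin \o (fun r => (H v r - H w r) * (s - r) `^ (a - 1))).
  apply: (integrableS _ _ _ (tame_RL_integrable ha hp (tameB tv tw) sS)) => //.
  by move=> r /=; rewrite !in_itv /=; move: eta0; lra.
have bound r : eta < r < s ->
    `|(H v r - H w r) * (s - r) `^ (a - 1)| <= (A * d) * (s - r) `^ (a - 1).
  move=> /andP[er rs]; rewrite normrM [`|_ `^ _|]ger0_norm ?powR_ge0 //.
  rewrite ler_wpM2r ?powR_ge0 // /H -mulrBr normrM.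
  have r0 : 0 < r by exact: lt_trans er.
  have /andP[c0 c1] := chi01 r.
  rewrite (ger0_norm c0) -[leRHS]mul1r ler_pM //.
  apply: (le_trans (Phi_lip _ _ r0)); rewrite ler_wpM2l // vwd // r0.
  exact: lt_trans sS.
have step : `|RL a (fun r => H v r - H w r) s| <= A * d * (euler_beta 1 a * (s - eta) `^ a).
  have h := @le_normr_Rintegral _ _ _ mu _ _ (measurable_itv `]eta, s[) iRL.
  rewrite RLE; apply: (le_trans h).
  rewrite -ki -(@RintegralZl _ _ _ mu _ _ (A * d) (measurable_itv `]eta, s[) ik); apply: le_Rintegral => //.
  - exact: (integrable_abse iRL).
  - exact: (@integrableZl _ _ _ mu _ (measurable_itv `]eta, s[) (A * d) _ ik).
apply: (le_trans (ler_wpM2l k0 step)).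
have B0 : 0 <= euler_beta 1 a by rewrite (le_trans ler01) // euler_beta_ge1.
apply: (@le_trans _ _ (d * (k * A * euler_beta 1 a * (M' - eta) `^ a))); last first.
  by rewrite ler_wpM2l.
rewrite (_ : k * (A * d * _) = d * (k * A * euler_beta 1 a * (s - eta) `^ a)); last first.
  set Be := euler_beta 1 a; set Po := powR _ _; ring.
rewrite ler_wpM2l // ler_wpM2l ?mulr_ge0 //.
apply: ge0_ler_powR; rewrite ?nnegrE; case/andP: ha => // a0 _.
- exact: ltW.
- by rewrite subr_ge0 ltW.
- by rewrite subr_ge0 (ltW (lt_trans etaM MM')).
- by rewrite lerD2r (ltW (lt_le_trans sS SM')).
Qed.

Let N := M' + 1.
Let M'N : M' < N. Proof. by rewrite ltrDl. Qed.
Let N0 : 0 < N.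
Proof. exact: lt_trans (lt_trans eta0 etaM) (lt_trans MM' M'N). Qed.

(* the iteration starts from [X] frozen from [eta] on, as [X] is not known to
   be bounded up to [M] *)
Let it n : R -> R := iter n T (fun s => X (Num.min s eta)).

Let it_continuous n s : 0 < s < N -> {for s, continuous (it n)}.
Proof.
elim: n s => [|n IH] s sN; last exact: (T_continuous N0 IH).
apply: (@continuous_comp _ _ _ (fun s => Num.min s eta) X).
  by apply: continuous_min; [exact: cvg_id|exact: cvg_cst].
apply: (proj1 X_tame); rewrite lt_min eta0 andbT gt_min etaM orbT andbT.
by case/andP: sN.
Qed.

Let T_fix_early v : (forall s, 0 < s <= eta -> v s = X s) ->
  forall s, 0 < s <= eta -> T v s = X s.
Proof.
move=> vX s /andP[s0 se]; rewrite /T X_eq ?s0 ?(le_lt_trans se) //.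
congr (_ + _ * _); apply: eq_RL => r /andP[r0 rs].
by rewrite /H vX // r0 (le_trans (ltW rs)).
Qed.

Let it_early n s : 0 < s <= eta -> it n s = X s.
Proof.
elim: n s => [|n IH] s sI; last exact: (T_fix_early IH).
by rewrite /it /= min_l //; case/andP: sI.
Qed.

Let it_cauchy : exists2 C, 0 <= C & forall n s, 0 < s < M' ->
  `|it n.+1 s - it n s| <= C / 2 ^+ n.
Proof.
have c10 s : eta <= s <= M' -> {for s, continuous (fun s => it 1 s - it 0 s)}.
  move=> /andP[es sM']; have sN : 0 < s < N.
    by rewrite (lt_le_trans eta0) //= (le_lt_trans sM').
  by apply: continuousB; exact: it_continuous.
have [C C0 hC] := continuous_segment_bound c10.
exists C => //; elim=> [|n IH] s /andP[s0 sM'].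
  rewrite expr0 divr1; have [se|es] := leP s eta.
    by rewrite !it_early ?s0 // subrr normr0.
  by apply: hC; rewrite !ltW.
rewrite exprS invfM mulrCA mulrC.
have sM0 : 0 < s < M' by rewrite s0.
apply: (@contraction (it n.+1) (it n) M') => //.
- by move=> r /andP[r0 rM]; apply: it_continuous; rewrite r0 (lt_trans rM).
- by move=> r /andP[r0 rM]; apply: it_continuous; rewrite r0 (lt_trans rM).
- by move=> r rI; rewrite !it_early.
Qed.

(** The iterates, shifted down by a geometric error bound, increase; their
    supremum is the limit, with the expected rate. *)
Lemma volterra_extension : exists v : R -> R,
  [/\ forall s, 0 < s < M' -> {for s, continuous v},
      forall s, 0 < s < M -> v s = X s
    & forall s, 0 < s < M' -> v s = zt s + k * RL a (H v) s].
Proof.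
have [C C0 itC] := it_cauchy.
pose lo s n := it n s - 2 * C / 2 ^+ n.
pose v s := sup [set lo s n | n in [set: nat]].
have half n : C / 2 ^+ n = 2 * C / 2 ^+ n.+1.
  by rewrite exprS invfM; field; rewrite expf_neq0.
(* consecutive iterates differ by at most [C / 2 ^ n], half of the shift *)
have lo_nd s : 0 < s < M' -> nondecreasing_seq (lo s).
  move=> sM; apply/nondecreasing_seqP => n; rewrite /lo -half.
  have := itC n s sM; rewrite ler_norml => /andP[h _].
  rewrite (_ : 2 * C / 2 ^+ n = C / 2 ^+ n + C / 2 ^+ n); last by ring.
  by move: h; lra.
have hi_ni s : 0 < s < M' -> nonincreasing_seq (fun n => it n s + 2 * C / 2 ^+ n).
  move=> sM; apply/nonincreasing_seqP => n; rewrite -half.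
  have := itC n s sM; rewrite ler_norml => /andP[_ h].
  rewrite (_ : 2 * C / 2 ^+ n = C / 2 ^+ n + C / 2 ^+ n); last by ring.
  by move: h; lra.
have lohi s m n : 0 < s < M' -> lo s m <= it n s + 2 * C / 2 ^+ n.
  move=> sM; have e0 j : 0 <= 2 * C / 2 ^+ j by rewrite divr_ge0 ?mulr_ge0 ?exprn_ge0.
  have [mn|/ltnW nm] := leqP m n.
    apply: (le_trans (lo_nd s sM _ _ mn)); rewrite /lo.
    by move: (e0 n); lra.
  apply: le_trans (hi_ni s sM _ _ nm); rewrite /lo.
  by move: (e0 m); lra.
have vit n s : 0 < s < M' -> `|v s - it n s| <= 2 * C / 2 ^+ n.
  move=> sM; rewrite ler_distl; apply/andP; split.
    apply: ub_le_sup; last by exists n.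
    by exists (it 0 s + 2 * C / 2 ^+ 0) => _ [m _ <-]; exact: lohi.
  by apply: ge_sup => [|_ [m _ <-]]; [exists (lo s 0), 0|exact: lohi].
have v_early s : 0 < s <= eta -> v s = X s.
  move=> sI; have sM : 0 < s < M'.
    by case/andP: sI => -> se; rewrite (le_lt_trans se) // (lt_trans etaM).
  apply/eqP; rewrite -subr_eq0 -normr_le0.
  apply: (@le0_geometric _ (2 * C)); first by rewrite mulr_ge0.
  by move=> n; rewrite -(@it_early n s sI) vit.
have cv s : 0 < s < M' -> {for s, continuous v}.
  move=> sM; apply/cvgrPdist_le => /= e e0.
  have [n nC] : exists n, 2 * C / 2 ^+ n <= e / 3.
    apply: contrapT => /forallNP h.
    have : e / 3 <= 0.
      apply: (@le0_geometric _ (2 * C)); first by rewrite mulr_ge0.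
      by move=> n; have := h n => /negP; rewrite -ltNge => /ltW.
    by move: e0; lra.
  have sN : 0 < s < N by case/andP: sM => -> sM; rewrite (lt_trans sM).
  have e3 : 0 < e / 3 by rewrite divr_gt0.
  have := @it_continuous n s sN => /cvgrPdist_le /(_ _ e3).
  have : \forall r \near s, 0 < r < M' by exact: near_oo sM _.
  apply: filterS2 => r rM itr.
  have -> : v s - v r = (v s - it n s) + (it n s - it n r) - (v r - it n r) by ring.
  apply: (le_trans (ler_normB _ _)).
  apply: (le_trans (lerD (ler_normD _ _) (lexx _))).
  have := vit n s sM; have := vit n r rM; move: nC itr => /=; lra.
have vT s : 0 < s < M' -> v s = T v s.
  move=> sM; apply/eqP; rewrite -subr_eq0 -normr_le0.
  apply: (@le0_geometric _ (2 * C)); first by rewrite mulr_ge0.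
  move=> n; have -> : v s - T v s = (v s - it n.+1 s) - (T v s - T (it n) s).
    by rewrite -[it n.+1 s]/(T (it n) s); ring.
  apply: (le_trans (ler_normB _ _)).
  have h : `|T v s - T (it n) s| <= (2 * C / 2 ^+ n) / 2.
    apply: (@contraction v (it n) M') => //.
    - by move=> r /andP[r0 rM]; apply: it_continuous; rewrite r0 (lt_trans rM).
    - by move=> r rI; rewrite v_early // it_early.
    - by move=> r; exact: vit.
  have := vit n.+1 s sM; rewrite -half.
  have -> : 2 * C / 2 ^+ n = C / 2 ^+ n + C / 2 ^+ n by ring.
  by move: h; rewrite (_ : 2 * C / 2 ^+ n / 2 = C / 2 ^+ n); [lra|field; rewrite expf_neq0].
exists v; split=> // s /andP[s0 sM].
pose S := (s + M) / 2; have [sS SM] : s < S /\ S < M by move: sM; rewrite /S; lra.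
have SM' : S <= M' by rewrite ltW // (lt_trans SM).
have cvS r : 0 < r < S -> {for r, continuous v}.
  by move=> /andP[r0 rS]; apply: cv; rewrite r0 (lt_le_trans rS).
have cXS r : 0 < r < S -> {for r, continuous X}.
  by move=> /andP[r0 rS]; apply: (proj1 X_tame); rewrite r0 (lt_trans rS).
have cd r : eta <= r <= S -> {for r, continuous (fun r => v r - X r)}.
  move=> /andP[er rS]; have r0 : 0 < r by exact: lt_le_trans er.
  apply: continuousB; first by apply: cv; rewrite r0 (le_lt_trans rS) // (lt_trans SM).
  by apply: (proj1 X_tame); rewrite r0 (le_lt_trans rS).
have [K K0 hK] := continuous_segment_bound cd.
have vXn n r : 0 < r < S -> `|v r - X r| <= K / 2 ^+ n.
  elim: n r => [|n IH] r /andP[r0 rS].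
    rewrite expr0 divr1; have [re|er] := leP r eta.
      by rewrite v_early ?r0 // subrr normr0.
    by apply: hK; rewrite !ltW.
  rewrite vT ?r0 ?(lt_le_trans rS) // X_eq ?r0 ?(lt_trans rS) //.
  have -> : K / 2 ^+ n.+1 = K / 2 ^+ n / 2 by rewrite exprS invfM mulrCA mulrC.
  by apply: (@contraction v X S) => //; rewrite r0.
apply/eqP; rewrite -subr_eq0 -normr_le0.
by apply: (@le0_geometric _ K) => // n; apply: vXn; rewrite s0.
Qed.

End Volterra.

(** * Continuation of Abel's equation with a forcing *)

Section Continuation.
Context {R : realType}.
Implicit Types (a b e p q s t x y c C M N d : R) (f g v w X : R -> R).

(** The window has length [2 * d]; the bound is the contraction constant. *)
Lemma small_window a M K : 0 < a -> 0 < M -> 0 <= K ->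
  exists2 d, 0 < d < M & K * (2 * d) `^ a <= 2^-1.
Proof.
move=> a0 M0 K0; pose e := (2 * (K + 1))^-1.
have e0 : 0 < e by rewrite invr_gt0 mulr_gt0 // ltr_wpDl.
have r0 : 0 < e `^ a^-1 by exact: powR_gt0.
exists (Num.min (M / 2) (e `^ a^-1 / 2)).
  by rewrite lt_min !divr_gt0 //= gt_min; apply/orP; left; lra.
set d := Num.min _ _; have d0 : 0 < d by rewrite lt_min !divr_gt0.
have de : 2 * d <= e `^ a^-1.
  by rewrite mulrC -ler_pdivlMr // /d ge_min lexx orbT.
have h : (2 * d) `^ a <= e.
  rewrite -[leRHS](powR_root' a0 (ltW e0)).
  by apply: ge0_ler_powR; rewrite ?nnegrE ?mulr_ge0 ?powR_ge0 // ltW.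
apply: (@le_trans _ _ ((K + 1) * e)).
  by rewrite ler_pM ?powR_ge0 // lerDl.
by rewrite /e invfM mulrCA mulfV ?mulr1 // gt_eqF // ltr_wpDl.
Qed.

(** It removes the forcing near [0], where its integrability is not known, and
    keeps all of it from [eta] on. *)
Definition cutoff eta r : R := Num.max 0 (Num.min 1 (2 * r / eta - 1)).

Lemma cutoff_continuous eta : continuous (cutoff eta).
Proof.
move=> r.
have -> : cutoff eta = (cst 0 \max (cst 1 \min (fun r => 2 * r / eta - 1))).
  by apply/funext.
apply: continuous_max; first exact: cvg_cst.
apply: continuous_min; first exact: cvg_cst.
apply: continuousB; last exact: cvg_cst.
apply: continuousM; last exact: cvg_cst.
by apply: continuousM; [exact: cvg_cst|exact: cvg_id].
Qed.

Lemma cutoff01 eta r : 0 <= cutoff eta r <= 1.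
Proof. by rewrite /cutoff le_max lexx /= ge_max ler01 ge_min lexx. Qed.

Lemma cutoff0 eta r : 0 < eta -> r <= eta / 2 -> cutoff eta r = 0.
Proof.
move=> eta0 re; apply/max_idPl; rewrite ge_min; apply/orP; right.
by rewrite subr_le0 ler_pdivrMr // mul1r; lra.
Qed.

Lemma cutoff1 eta r : 0 < eta -> eta <= r -> cutoff eta r = 1.
Proof.
move=> eta0 re; rewrite /cutoff min_l; first by rewrite max_r // ler01.
by rewrite lerBrDr ler_pdivlMr //; lra.
Qed.

(** [z] takes over the part [1 - chi] of the forcing, the Volterra equation the
    part [chi]; applying [RL (1 - a)] to the fixed point puts them together
    again. *)
Lemma abel_equation_continuation a p q M c A (Phi : R -> R -> R) X :
  0 < a < 1 -> 0 <= p < 1 -> 0 <= q -> 0 < M -> 0 <= A ->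
  (forall z : R * R, 0 < z.1 ->
     {for z, continuous (fun z : R * R => Phi z.1 z.2)}) ->
  (forall s x y, 0 < s -> `|Phi s x - Phi s y| <= A * `|x - y|) ->
  tame p M X ->
  (forall s, 0 < s < M ->
     is_derive s 1 (fun s => RL (1 - a) X s - c * s `^ q) (Phi s (X s))) ->
  exists M' v, [/\ M < M', tame p M' v, forall s, 0 < s < M -> v s = X s
    & forall s, 0 < s < M' ->
      is_derive s 1 (fun s => RL (1 - a) v s - c * s `^ q) (Phi s (v s))].
Proof.
move=> a01 hp q0 M0 A0 Phi_cont Phi_lip tX dP.
pose b := 1 - a.
have ha : 0 < a <= 1 by move: a01; lra.
have hb : 0 < b <= 1 by rewrite /b; move: a01; lra.
have a0 : 0 < a by case/andP: ha.
have b0 : 0 < b by case/andP: hb.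
have ba1 : b + a = 1 by rewrite /b subrK.
have ba_le1 : b + a <= 1 by rewrite ba1.
pose B := euler_beta a b.
have B1 : 1 <= B by exact: euler_beta_ge1.
have B0 : B != 0 by rewrite gt_eqF // (lt_le_trans ltr01).
pose k := B^-1; have k0 : 0 <= k by rewrite invr_ge0 (le_trans ler01).
have h1 : 0 < (1 : R) <= 1 by rewrite ltr01 lexx.
have K0 : 0 <= k * A * euler_beta 1 a.
  apply: mulr_ge0; first exact: mulr_ge0.
  exact: le_trans ler01 (euler_beta_ge1 h1 ha).
have [d /andP[d0 dM] dK] := small_window a0 M0 K0.
pose eta := M - d; pose M' := M + d.
have eta0 : 0 < eta by rewrite subr_gt0.
have etaM : eta < M by rewrite /eta; lra.
have MM' : M < M' by rewrite /M'; lra.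
have small : k * A * euler_beta 1 a * (M' - eta) `^ a <= 2^-1.
  by rewrite (_ : M' - eta = 2 * d) // /M' /eta; ring.
have RLab f N s : tame p N f -> s < N -> RL b (fun r => k * RL a f r) s = RL 1 f s.
  move=> tf sN; have N0 : s < N := sN.
  have [s0|s0] := leP s 0.
    by rewrite /RL set_itv_ge ?Rintegral_set0 // bnd_simp -leNgt.
  rewrite (RLZ k hb hp (tame_RL ha hp tf (lt_trans s0 sN)) sN).
  rewrite (RL_semigroup b0 a0 ba_le1 hp tf sN) ba1 mulrA.
  by rewrite /k mulVf // mul1r.
pose chi := cutoff eta.
have chi0 s : s <= eta / 2 -> chi s = 0 by exact: cutoff0.
have chi1 s : eta <= s -> chi s = 1 by exact: cutoff1.
pose F v := cutoff_forcing Phi chi v.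
have tame_F v N : (forall s, 0 < s < N -> {for s, continuous v}) -> tame p N (F v).
  exact: (tame_forcing hp eta0 Phi_cont (@cutoff_continuous eta) chi0).
have tF : tame p M (F X) by exact: tame_F (proj1 tX).
(* the part of the solution that is generated by the early forcing: after
     [eta] the right-hand side of its equation has derivative [0] apart from
     the power *)
pose z r := X r - k * RL a (F X) r.
have tRLF : tame p M (fun r => k * RL a (F X) r).
  by apply: tameZ; exact: tame_RL.
have tz : tame p M z by exact: tameB.
have RLz s : s < M -> RL b z s = RL b X s - RL 1 (F X) s.
  by move=> sM; rewrite (RLB hb hp tX tRLF sM) (RLab _ _ _ tF sM).
pose P s := RL b X s - c * s `^ q.
pose p0 := P eta - RL 1 (F X) eta.
have zE s : eta <= s < M -> RL (1 - a) z s = c * s `^ q + p0.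
  move=> /andP[es sM]; rewrite -/b RLz //.
  have PE : P s - p0 = RL 1 (F X) s.
    apply: (@is_derive_eq_cst _ (fun s => P s - p0) (RL 1 (F X)) eta s
      (fun r => Phi r (X r))) => //.
    - move=> r /andP[er rs]; have rM : 0 < r < M.
        by rewrite (lt_le_trans eta0) //= (le_lt_trans rs).
      rewrite -[Phi r (X r)]subr0.
      exact: (is_deriveB (dP r rM) (is_derive_cst p0 r 1)).
    - move=> r /andP[er rs]; have rM : 0 < r < M.
        by rewrite (lt_le_trans eta0) //= (le_lt_trans rs).
      have := RL1_derive hp tF rM.
      by rewrite {2}/F /cutoff_forcing chi1 // mul1r.
    - by rewrite /p0 opprB addrC subrK.
  by rewrite -PE /P; set y := RL b X s; lra.
have [zt [tzt ztz RLzt]] := abel_extension a01 hp q0 eta0 etaM tz zE.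
have XE s : 0 < s < M -> X s = zt s + k * RL a (F X) s.
  by move=> sM; rewrite ztz // /z subrK.
have [v [cv vX vE]] := volterra_extension ha hp eta0 etaM MM' Phi_cont Phi_lip
  A0 k0 (@cutoff_continuous eta) (@cutoff01 eta) chi0 tzt tX XE small.
have tv : tame p M' v.
  split=> //; have [_ [e [C [e0 XC]]]] := tX.
  exists (Num.min e M), C; split; first by rewrite lt_min e0.
  move=> r /andP[r0]; rewrite lt_min => /andP[re rM].
  by rewrite vX ?r0 //; apply: XC; rewrite r0.
have tFv : tame p M' (F v) by exact: tame_F cv.
have M'0 : 0 < M' by exact: lt_trans MM'.
have tRLFv : tame p M' (fun r => k * RL a (F v) r).
  by apply: tameZ; exact: tame_RL.
exists M', v; split=> // s /andP[s0 sM'].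
have [sM|Ms] := ltP s M.
  rewrite vX ?s0 //; apply: (@is_derive_eq_oo _ P _ 0 M); first by rewrite s0.
    move=> r /andP[r0 rM]; rewrite /P; congr (_ - _); apply: eq_RL => y /andP[y0 yr].
    by rewrite vX // y0 (lt_trans yr).
  by apply: dP; rewrite s0.
have es : eta < s by exact: lt_le_trans Ms.
apply: (@is_derive_eq_oo _ (fun s => p0 + RL 1 (F v) s) _ eta M').
- by rewrite es.
- move=> r /andP[er rM']; have r0 : 0 < r by exact: lt_trans er.
  rewrite (@eq_RL _ (1 - a) v (fun r => zt r + k * RL a (F v) r)); last first.
    by move=> y /andP[y0 yr]; rewrite vE // y0 (lt_trans yr).
  rewrite (RLD hb hp (tzt M') tRLFv rM') (RLab _ _ _ tFv rM') RLzt ?(ltW er) //.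
  by set y := RL 1 _ r; lra.
- rewrite -[Phi s (v s)]add0r.
  have sI : 0 < s < M' by rewrite s0.
  have := RL1_derive hp tFv sI; rewrite {2}/F /cutoff_forcing chi1 ?(ltW es) // mul1r.
  exact: (is_deriveD (is_derive_cst p0 s 1)).
Qed.

End Continuation.

(** * Katugampola integrals *)

Section Katugampola.
Context {R : realType}.
Implicit Types (rho sigma alpha p q s t u M z : R) (x : R -> R).
Local Notation mu := (@lebesgue_measure R).

(** The integrand is at most [u ^ (z - 1)] near [0] and [expR (- u)] near
    infinity. *)
Lemma Gamma_gt0 z : 0 < z <= 1 -> 0 < Gamma z.
Proof.
move=> /andP[z0 z1].
pose f (u : R) := u `^ (z - 1) * expR (- u).
have f0 u : 0 <= f u by rewrite mulr_ge0 ?powR_ge0 ?expR_ge0.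
have mexp : measurable_fun setT (fun u : R => expR (- u)).
  exact: (measurableT_comp (@measurable_expR R)).
have mf : measurable_fun setT f.
  by apply: measurable_funM => //; exact: measurable_powR.
have iexp : mu.-integrable setT (EFin \o exponential_pdf (1 : R)).
  apply/integrableP; split.
    by apply/measurable_EFinP; exact: measurable_exponential_pdf.
  under eq_integral do rewrite gee0_abs ?lee_fin ?exponential_pdf_ge0 //.
  by rewrite integral_exponential_pdf // ltry.
have ipow : mu.-integrable setT
    ((fun u : R => (u `^ (z - 1))%:E) \_ `]0%R, 1%R[)%E.
  by apply/(integrable_mkcond _ _).1 => //; exact: integrable_powR01.
have ifin : (\int[mu]_(u in `]0%R, +oo[) (f u)%:E < +oo)%E.
  have /integrableP[_] := integrableD measurableT ipow iexp.
  apply: le_lt_trans; rewrite [leLHS]integral_mkcond; apply: ge0_le_integral => //.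
  - by move=> u _; apply: erestrict_ge0 => r _; rewrite lee_fin.
  - apply/(measurable_restrictT _ _).1 => //.
    by apply/measurable_EFinP; apply: measurable_funTS.
  - apply: measurableT_comp => //.
    by apply: emeasurable_funD; [case/integrableP: ipow|case/integrableP: iexp].
  - move=> u _; apply: le_trans (lee_abs _).
    rewrite !patchE; case: ifPn; last first.
      move=> _; apply: adde_ge0; last by rewrite lee_fin exponential_pdf_ge0.
      by case: ifP => // _; rewrite lee_fin powR_ge0.
    rewrite inE /= in_itv /= andbT => u0.
    have pdf : exponential_pdf (1 : R) u = expR (- u).
      rewrite /exponential_pdf patchE mem_set /=; last by rewrite in_itv /= ltW.
      by rewrite mul1r mulN1r.
    rewrite pdf; have [u1|u1] := ltP u 1.
      rewrite mem_set /=; last by rewrite in_itv /= u0.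
      rewrite -EFinD lee_fin /f; have := powR_ge0 u (z - 1).
      have : expR (- u) <= 1 by rewrite -expR0 ler_expR oppr_le0 ltW.
      by have := expR_ge0 (- u); nra.
    rewrite memNset /=; last by rewrite in_itv /= u0 /=; apply/negP; rewrite -leNgt.
    rewrite add0e lee_fin /f; have : u `^ (z - 1) <= 1.
      rewrite -[leRHS](one_powR (z - 1)); apply: le_powR_neg => //.
      by rewrite subr_le0.
    by have := expR_ge0 (- u); nra.
have ipos : (0 < \int[mu]_(u in `]0%R, +oo[) (f u)%:E)%E.
  apply: (@lt_le_trans _ _ (expR (- 1))%:E); first by rewrite lte_fin expR_gt0.
  rewrite -integral01_cst.
  apply: (@le_trans _ _ (\int[mu]_(u in `]0%R, 1%R[) (f u)%:E)%E).
    apply: ge0_le_integral => //.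
    - by apply/measurable_EFinP; apply: measurable_funTS.
    - move=> u; rewrite /= in_itv /= => /andP[u0 u1]; rewrite lee_fin /f.
      have : 1 <= u `^ (z - 1).
        by apply: powR_neg_ge1; [rewrite subr_le0| |exact: ltW].
      have : expR (- 1) <= expR (- u) by rewrite ler_expR lerN2 ltW.
      by have := expR_ge0 (- u); nra.
  apply: ge0_subset_integral => //.
    by apply/measurable_EFinP; apply: measurable_funTS.
    by move=> u _; rewrite lee_fin.
  by move=> u /=; rewrite !in_itv /= andbT => /andP[].
by apply: fine_gt0; rewrite ipos.
Qed.

(** The function [x] in the variable [s = t ^ rho], in which the
    Katugampola integrals become convolutions. *)
Definition rescale rho x s : R := x (s `^ rho^-1).

Lemma rescale_powR rho x t : 0 < rho -> 0 < t -> rescale rho x (t `^ rho) = x t.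
Proof. by move=> rho0 t0; rewrite /rescale powR_root // ltW. Qed.

Definition kat_coef rho sigma : R := rho `^ (1 - sigma) / Gamma sigma / rho.

Lemma kat_coef_gt0 rho sigma : 0 < rho -> 0 < sigma <= 1 -> 0 < kat_coef rho sigma.
Proof. by move=> rho0 hs; rewrite !divr_gt0 ?powR_gt0 ?Gamma_gt0. Qed.

(** The substitution [s = tau ^ rho] in the defining integral. *)
Lemma kat_intE rho sigma p M x t : 0 < rho -> 0 < sigma <= 1 -> 0 <= p < 1 ->
  tame p M (rescale rho x) -> 0 < t -> t `^ rho < M ->
  kat_int rho sigma x t = kat_coef rho sigma * RL sigma (rescale rho x) (t `^ rho).
Proof.
move=> rho0 hs hp tx t0 tM; rewrite /kat_int gt_eqF; last by case/andP: hs.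
rewrite /kat_coef -[in RHS]mulrA; congr (_ * _).
rewrite /RL -RintegralZl //; last exact: tame_RL_integrable hs hp tx tM.
rewrite (Rintegral_substitution_powR rho0 t0); last first.
  move=> y /andP[y0 yt]; apply: continuousM; first exact: cvg_cst.
  apply: continuousM; first by apply: (proj1 tx); rewrite y0 (lt_trans yt).
  apply: (@continuous_comp _ _ _ (fun u : R => t `^ rho - u) (@powR R ^~ (sigma - 1))).
    by apply: continuousB; [exact: cvg_cst|exact: cvg_id].
  by apply: continuous_powR; rewrite subr_gt0.
apply: eq_Rintegral => tau; rewrite inE /= in_itv /= => /andP[tau0 taut].
rewrite rescale_powR // -[sigma - 1]opprB powRN.
set y := _^-1; set w := tau `^ _; rewrite [LHS]/=.
by field; rewrite gt_eqF.
Qed.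

Lemma eq_kat_int rho sigma x y t : 0 < t -> (forall r, 0 < r <= t -> x r = y r) ->
  kat_int rho sigma x t = kat_int rho sigma y t.
Proof.
move=> t0 xy; rewrite /kat_int; case: ifP => _; first by rewrite xy // t0 lexx.
congr (_ * _); apply: eq_Rintegral => r; rewrite inE /= in_itv /= => /andP[r0 rt].
by rewrite xy // r0 ltW.
Qed.

Lemma RL_cst sigma p M s (c : R) : 0 < sigma <= 1 -> 0 <= p < 1 -> 0 < s < M ->
  RL sigma (fun=> c) s = c * (RL sigma (@powR R ^~ 0) 1 * s `^ sigma).
Proof.
move=> hs hp /andP[s0 sM].
rewrite (@eq_RL _ _ _ (fun r => c * r `^ 0)); last by move=> r _; rewrite powRr0 mulr1.
rewrite (RLZ c hs hp (tame_powR M (proj1 (andP hp)) (lexx 0)) sM).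
by rewrite (RL_powR hs (lexx 0) s0) addr0.
Qed.

(** Composing the two integrals of the Hilfer-Katugampola derivative leaves a
    single one, of order [1 - alpha]; the cases [beta = 0] and [beta = 1] are
    those in which one of the two is the identity. *)
Lemma hk_primitiveE rho alpha beta : 0 < rho -> 0 < alpha < 1 -> 0 <= beta <= 1 ->
  exists k c, 0 < k /\ forall p M x t, 0 <= p < 1 -> tame p M (rescale rho x) ->
    0 < t -> t `^ rho < M ->
    hk_primitive rho alpha beta x t =
    k * RL (1 - alpha) (rescale rho x) (t `^ rho)
    - c * value0 (kat_int rho ((1 - alpha) * (1 - beta)) x)
      * (t `^ rho) `^ (beta * (1 - alpha)).
Proof.
move=> rho0 ha hb.
pose s1 := (1 - alpha) * (1 - beta); pose s2 := beta * (1 - alpha).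
have s10 : 0 <= s1 by rewrite mulr_ge0 //; lra.
have s20 : 0 <= s2 by rewrite mulr_ge0 //; lra.
have s12 : s1 + s2 = 1 - alpha by rewrite /s1 /s2; ring.
rewrite /hk_primitive -/s1 -/s2.
have [s1z|s1nz] := eqVneq s1 0.
  have hs2 : 0 < s2 <= 1 by move: s12; rewrite s1z; lra.
  have s2E : s2 = 1 - alpha by rewrite -s12 s1z add0r.
  have kat0 x : kat_int rho s1 x = x by apply/funext => t; rewrite /kat_int s1z eqxx.
  exists (kat_coef rho s2), (kat_coef rho s2 * RL s2 (@powR R ^~ 0) 1).
  split=> [|p M x t hp tx t0 tM]; first exact: kat_coef_gt0.
  have t0' : 0 < t `^ rho < M by rewrite powR_gt0.
  have tc := tame_cst M (value0 x) (proj1 (andP hp)).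
  rewrite kat0 (kat_intE rho0 hs2 hp (tameB tx tc) t0 tM).
  rewrite (RLB hs2 hp tx tc tM) (RL_cst _ hs2 hp t0') s2E.
  by set u := RL _ _ _; set v := RL _ _ _; ring.
have hs1 : 0 < s1 <= 1 by rewrite lt_neqAle eq_sym s1nz s10 /=; move: s12; lra.
have [s2z|s2nz] := eqVneq s2 0.
  have s1E : s1 = 1 - alpha by rewrite -s12 s2z addr0.
  exists (kat_coef rho s1), 1.
  split=> [|p M x t hp tx t0 tM]; first exact: kat_coef_gt0.
  rewrite s2z {1}/kat_int eqxx (kat_intE rho0 hs1 hp tx t0 tM) -s1E.
  by rewrite powRr0 mulr1 mul1r.
have hs2 : 0 < s2 <= 1 by rewrite lt_neqAle eq_sym s2nz s20 /=; move: s12; lra.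
pose k1 := kat_coef rho s1; pose k2 := kat_coef rho s2.
have k10 : 0 < k1 by exact: kat_coef_gt0.
have k20 : 0 < k2 by exact: kat_coef_gt0.
exists (k2 * k1 * euler_beta s1 s2), (k2 * RL s2 (@powR R ^~ 0) 1); split.
  apply: mulr_gt0; first exact: mulr_gt0.
  exact: lt_le_trans ltr01 (euler_beta_ge1 hs1 hs2).
move=> p M x t hp tx t0 tM; set y0 := value0 _.
have t0' : 0 < t `^ rho < M by rewrite powR_gt0.
have M0 : 0 < M by case/andP: t0' => h; exact: lt_trans.
have tc := tame_cst M y0 (proj1 (andP hp)).
have tk := tameZ k1 (tame_RL hs1 hp tx M0).
have yE s : 0 < s < M ->
    rescale rho (fun s => kat_int rho s1 x s - y0) s = k1 * RL s1 (rescale rho x) s - y0.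
  move=> /andP[sp sM]; have r0 : 0 < s `^ rho^-1 by exact: powR_gt0.
  have rE : (s `^ rho^-1) `^ rho = s by rewrite powR_root' // ltW.
  by rewrite {1}/rescale (kat_intE rho0 hs1 hp tx r0) rE.
have ty : tame p M (rescale rho (fun s => kat_int rho s1 x s - y0)).
  by apply: tame_ext (tameB tk tc) => // s sI; rewrite yE.
rewrite (kat_intE rho0 hs2 hp ty t0 tM).
rewrite (@eq_RL _ _ _ (fun s => k1 * RL s1 (rescale rho x) s - y0)); last first.
  by move=> s /andP[sp st]; rewrite yE // sp (lt_trans st).
rewrite (RLB hs2 hp tk tc tM) (RLZ k1 hs2 hp (tame_RL hs1 hp tx M0) tM).
have s21 : s2 + s1 <= 1 by move: s12; lra.
rewrite (RL_semigroup (proj1 (andP hs2)) (proj1 (andP hs1)) s21 hp tx tM).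
rewrite (RL_cst _ hs2 hp t0') (addrC s2) s12 -/k2.
by set u := RL _ _ _; set v := RL _ _ _; set B := euler_beta _ _; ring.
Qed.

End Katugampola.

(** * Solutions and their continuations *)

Section Solutions.
Context {R : realType}.
Implicit Types (rho alpha beta gamma lambda p q s t u m b A : R) (x y f g : R -> R).

Lemma near_right0 e (P : R -> Prop) : 0 < e ->
  (forall t, 0 < t < e -> P t) -> \forall t \near 0^'+, P t.
Proof.
move=> e0 h; near=> t; apply: h; apply/andP; split; near: t.
  exact: nbhs_right_gt.
exact: nbhs_right_lt.
Unshelve. all: by end_near. Qed.

Lemma eq_value0 e f g : 0 < e -> (forall t, 0 < t < e -> f t = g t) ->
  value0 f = value0 g.
Proof.
move=> e0 fg; rewrite /value0; congr (lim _); apply/seteqP; split.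
  by apply: near_eq_cvg; apply: near_right0 e0 _ => t /fg ->.
by apply: near_eq_cvg; apply: near_right0 e0 _ => t /fg ->.
Qed.

Lemma extend0_pos g t : 0 < t -> extend0 g t = g t.
Proof. by move=> t0; rewrite /extend0 gt_eqF. Qed.

Lemma continuous_weight rho gamma t : 0 < rho -> 0 < t ->
  {for t, continuous (fun t => (t `^ rho / rho) `^ (1 - gamma))}.
Proof.
move=> rho0 t0.
apply: (@continuous_comp _ _ _ (fun t => t `^ rho / rho) (@powR R ^~ (1 - gamma))).
  by apply: continuousM; [exact: continuous_powR|exact: cvg_cst].
by apply: continuous_powR; rewrite divr_gt0 ?powR_gt0.
Qed.

Section Weighted.
Variables (rho gamma m : R) (x : R -> R).
Hypotheses (rho0 : 0 < rho) (m0 : 0 < m).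
Hypothesis xC : forall b, 0 < b -> b < m -> in_Cw rho gamma b x.

Lemma in_Cw_continuous t : 0 < t < m -> {for t, continuous x}.
Proof.
move=> /andP[t0 tm].
pose b := (t + m) / 2; have [tb bm] : t < b /\ b < m by rewrite /b; lra.
have b0 : 0 < b by exact: lt_trans tb.
have := xC b0 bm; rewrite /in_Cw /in_C => /(continuous_within_itvP _ b0)[cW _ _].
have cWt : {for t, continuous (weighted rho gamma x)}.
  apply: (@continuous_for_eq_oo _ (extend0 (weighted rho gamma x)) _ 0 m).
  - by rewrite t0.
  - by move=> r /andP[r0 _]; rewrite extend0_pos.
  - by apply: cW; rewrite in_itv /= t0.
have w0 r : 0 < r -> (r `^ rho / rho) `^ (1 - gamma) != 0.
  by move=> r0; rewrite gt_eqF // powR_gt0 // divr_gt0 // powR_gt0.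
apply: (@continuous_for_eq_oo _ (fun r =>
  weighted rho gamma x r * ((r `^ rho / rho) `^ (1 - gamma))^-1) _ 0 m).
- by rewrite t0.
- by move=> r /andP[r0 _]; rewrite /weighted mulrAC mulfV ?w0 // mul1r.
- apply: continuousM; first exact: cWt.
  by apply: continuousV; [exact: w0|exact: continuous_weight].
Qed.

Lemma weighted_cvg0 : extend0 (weighted rho gamma x) t @[t --> 0^'+] -->
  value0 (weighted rho gamma x).
Proof.
have b0 : 0 < m / 2 by rewrite divr_gt0.
have bm : m / 2 < m by move: m0; lra.
have := xC b0 bm; rewrite /in_Cw /in_C => /(continuous_within_itvP _ b0)[_ + _].
by rewrite [X in _ --> X]/extend0 eqxx.
Qed.

Lemma tame_rescale : tame (1 - gamma) (m `^ rho) (rescale rho x).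
Proof.
split=> [s /andP[s0 sm]|].
  apply: (@continuous_comp _ _ _ (@powR R ^~ rho^-1) x); first exact: continuous_powR.
  apply: in_Cw_continuous; rewrite powR_gt0 //=.
  rewrite -[ltRHS](powR_root rho0 (ltW m0)).
  by apply: gt0_ltr_powR; rewrite ?invr_gt0 // nnegrE ?powR_ge0 // ltW.
have /cvgrPdist_le/(_ 1 ltr01)[e /= e0 he] := weighted_cvg0.
set l := value0 _ in he.
exists (e `^ rho), ((`|l| + 1) * rho `^ (1 - gamma)).
split=> [|s /andP[s0 se]]; first exact: powR_gt0.
pose t := s `^ rho^-1; have t0 : 0 < t by exact: powR_gt0.
have ts : t `^ rho = s by rewrite powR_root' // ltW.
have te : t < e.
  rewrite -[ltRHS](powR_root rho0 (ltW e0)).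
  by apply: gt0_ltr_powR; rewrite ?invr_gt0 // nnegrE ?powR_ge0 // ltW.
have wt : `|weighted rho gamma x t| <= `|l| + 1.
  have /= := he t; rewrite sub0r normrN gtr0_norm // extend0_pos // => /(_ te t0) h.
  rewrite -[weighted _ _ _ _](subKr l); apply: (le_trans (ler_normB _ _)).
  by rewrite lerD2l.
rewrite /rescale -/t; move: wt; rewrite /weighted ts normrM ger0_norm ?powR_ge0 //.
rewrite powRM ?invr_ge0 ?(ltW s0) ?(ltW rho0) // => wt.
have sp : s `^ (1 - gamma) * s `^ (- (1 - gamma)) = 1.
  by rewrite powRN mulfV // gt_eqF // powR_gt0.
have rp : rho^-1 `^ (1 - gamma) * rho `^ (1 - gamma) = 1.
  by rewrite -powRM ?invr_ge0 ?(ltW rho0) // mulVf ?one_powR // gt_eqF.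
rewrite -[leRHS]mulrA (_ : `|x t| = s `^ (1 - gamma) * rho^-1 `^ (1 - gamma) * `|x t| *
  (rho `^ (1 - gamma) * s `^ (- (1 - gamma)))); last first.
  transitivity (`|x t| * (s `^ (1 - gamma) * s `^ (- (1 - gamma))) *
    (rho^-1 `^ (1 - gamma) * rho `^ (1 - gamma))); last by ring.
  by rewrite sp rp !mulr1.
by rewrite ler_wpM2r // mulr_ge0 ?powR_ge0.
Qed.

End Weighted.

(** Extending past the end point a solution on a bounded interval: the
    continuation of Abel's equation, read in the variable [t ^ rho]. *)
Lemma continuation_exists rho alpha beta (x0 : R) (phi : R -> R -> R) A m x :
  0 < rho -> 0 < alpha < 1 -> 0 <= beta <= 1 ->
  {within [set z : R * R | 0 < z.1], continuous (fun z : R * R => phi z.1 z.2)} ->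
  0 <= A ->
  (forall t u v : R, 0 < t -> `|phi t u - phi t v| <= A * `|u - v|) ->
  0 < m -> is_solution rho alpha beta x0 phi m%:E x ->
  exists (mu' : \bar R) x', is_continuation rho alpha beta x0 phi m%:E x mu' x'.
Proof.
move=> rho0 ha hb phi_cont A0 phi_lip m0 [].
set gamma := alpha + beta * (1 - alpha) => xC xD xI.
have pE : 1 - gamma = (1 - alpha) * (1 - beta) by rewrite /gamma; ring.
have hp : 0 <= 1 - gamma < 1.
  rewrite pE; apply/andP; split; first by rewrite mulr_ge0 //; lra.
  by move: ha hb => /andP[? ?] /andP[? ?]; nra.
set q := beta * (1 - alpha).
have q0 : 0 <= q by rewrite mulr_ge0 //; lra.
have [k [c [k0 hkE]]] := hk_primitiveE rho0 ha hb.
pose M := m `^ rho; have M0 : 0 < M by exact: powR_gt0.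
have xC' b : 0 < b -> b < m -> in_Cw rho gamma b x.
  by move=> b0 bm; apply: xC; rewrite ?lte_fin.
have tX : tame (1 - gamma) M (rescale rho x) := tame_rescale rho0 m0 xC'.
pose y0 := value0 (kat_int rho ((1 - alpha) * (1 - beta)) x).
pose c' := c * y0 / k.
pose Phi s u := (rho * k)^-1 * phi (s `^ rho^-1) u.
have kN : k != 0 by rewrite gt_eqF.
have rhoN : rho != 0 by rewrite gt_eqF.
have root_lt s : 0 < s -> forall t, 0 < t -> s < t `^ rho -> s `^ rho^-1 < t.
  move=> s0 t t0 st; rewrite -[ltRHS](powR_root rho0 (ltW t0)).
  by apply: gt0_ltr_powR; rewrite ?invr_gt0 // nnegrE ?powR_ge0 // ltW.
have pow_lt t s : 0 < t -> 0 < s -> t < s `^ rho^-1 -> t `^ rho < s.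
  move=> t0 s0 ts; rewrite -[ltRHS](powR_root' rho0 (ltW s0)).
  by apply: gt0_ltr_powR; rewrite // nnegrE ?powR_ge0 // ltW.
have dX s : 0 < s < M -> is_derive s 1
    (fun s => RL (1 - alpha) (rescale rho x) s - c' * s `^ q)
    (Phi s (rescale rho x s)).
  move=> /andP[s0 sM]; pose t := s `^ rho^-1.
  have t0 : 0 < t by exact: powR_gt0.
  have tm : t < m by exact: root_lt.
  have [] := xD t t0; rewrite ?lte_fin //.
  rewrite /hk_derivable /hk_deriv => dh hE.
  have dh' : is_derive t 1 (hk_primitive rho alpha beta x) (t `^ (rho - 1) * phi t (x t)).
    split=> //; rewrite -derive1E -hE mulrA -powRD; last first.
      by apply/implyP => _; rewrite gt_eqF.
    by rewrite addrA subrK subrr powRr0 mul1r.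
  have dr : is_derive s 1 (@powR R ^~ rho^-1) (rho^-1 * s `^ (rho^-1 - 1)).
    exact: is_derive1_powR.
  have dC := @is_derive1_comp _ (hk_primitive rho alpha beta x)
    (@powR R ^~ rho^-1) s _ _ dh' dr.
  apply: (@is_derive_eq_oo _ (fun s => k^-1 * hk_primitive rho alpha beta x (s `^ rho^-1)) _ 0 M).
  - by rewrite s0.
  - move=> r /andP[r0 rM]; have rr : (r `^ rho^-1) `^ rho = r by rewrite powR_root' // ltW.
    rewrite (hkE _ M x _ hp tX) ?rr ?powR_gt0 // -/y0 -/q /c'.
    by set w := RL _ _ _; field.
  - have := is_deriveZ k^-1 dC; move=> /is_derive_eq; apply.
    rewrite /GRing.scale /= /Phi /rescale -/t.
    have e1 : t `^ (rho - 1) * s `^ (rho^-1 - 1) = 1.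
      rewrite /t -powRrM -powRD; last by apply/implyP => _; rewrite gt_eqF.
      rewrite (_ : _ + _ = 0) ?powRr0 //; by field.
    rewrite (_ : k^-1 * _ = (rho * k)^-1 * phi t (x t) *
      (t `^ (rho - 1) * s `^ (rho^-1 - 1))); last by field; rewrite kN rhoN.
    by rewrite e1 mulr1.
have a01 : 0 < alpha < 1 by [].
have A'0 : 0 <= (rho * k)^-1 * A.
  by rewrite mulr_ge0 // invr_ge0 mulr_ge0 // ltW.
have Phi_lip s u v : 0 < s -> `|Phi s u - Phi s v| <= (rho * k)^-1 * A * `|u - v|.
  move=> s0; rewrite /Phi -mulrBr normrM -mulrA ger0_norm; last first.
    by rewrite invr_ge0 mulr_ge0 // ltW.
  by rewrite ler_wpM2l ?phi_lip ?powR_gt0 // invr_ge0 mulr_ge0 // ltW.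
have Phi_cont (z : R * R) : 0 < z.1 ->
    {for z, continuous (fun z : R * R => Phi z.1 z.2)}.
  move=> z0; apply: continuousM; first exact: cvg_cst.
  have op : open [set z : R * R | 0 < z.1].
    apply: (@open_comp _ _ (fun z : R * R => z.1) [set t | 0 < t]) => [w _|].
      exact: cvg_fst.
    exact: open_gt.
  move: phi_cont; rewrite continuous_open_subspace // => phi_cont.
  apply: (@continuous2_cvg _ _ _ _ _ _ (fun z : R * R => z.1 `^ rho^-1)
    (fun z : R * R => z.2) phi (z.1 `^ rho^-1) z.2).
  - apply: (phi_cont (z.1 `^ rho^-1, z.2)).
    by rewrite inE /= powR_gt0.
  - apply: (@continuous_comp _ _ _ (fun z : R * R => z.1) (@powR R ^~ rho^-1)).
      exact: cvg_fst.
    exact: continuous_powR.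
  - exact: cvg_snd.
have [M' [v [MM' tv vX dv]]] :=
  abel_equation_continuation a01 hp q0 M0 A'0 Phi_cont Phi_lip tX dX.
have M'0 : 0 < M' by exact: lt_trans MM'.
pose m' := M' `^ rho^-1; have m'0 : 0 < m' by exact: powR_gt0.
have mm' : m < m'.
  rewrite -[ltLHS](powR_root rho0 (ltW m0)).
  by apply: gt0_ltr_powR; rewrite ?invr_gt0 // nnegrE ?powR_ge0 // ltW.
pose x' t := v (t `^ rho).
have x'E s : 0 < s -> rescale rho x' s = v s.
  by move=> s0; rewrite /rescale /x' powR_root' // ltW.
have tx' : tame (1 - gamma) M' (rescale rho x').
  by apply: tame_ext tv => // s /andP[s0 _]; rewrite x'E.
have xx' t : 0 < t < m -> x' t = x t.
  move=> /andP[t0 tm]; rewrite /x' vX ?rescale_powR // powR_gt0 //=.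
  by apply: gt0_ltr_powR; rewrite // nnegrE ltW.
have kx' sigma t : 0 < t < m -> kat_int rho sigma x' t = kat_int rho sigma x t.
  move=> /andP[t0 tm]; apply: eq_kat_int => // r /andP[r0 rt].
  by rewrite xx' // r0 (le_lt_trans rt).
have cx' t : 0 < t < m' -> {for t, continuous x'}.
  move=> /andP[t0 tm]; apply: (@continuous_comp _ _ _ (@powR R ^~ rho) v).
    exact: continuous_powR.
  by apply: (proj1 tv); rewrite powR_gt0 //= pow_lt.
exists m'%:E, x'; split; first split; rewrite -/gamma.
- move=> b b0; rewrite lte_fin => bm'; rewrite /in_Cw /in_C.
  have cW t : 0 < t < m' -> {for t, continuous (extend0 (weighted rho gamma x'))}.
    move=> tm; apply: (@continuous_for_eq_oo _ (weighted rho gamma x') _ 0 m') => //.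
      by move=> r /andP[r0 _]; rewrite extend0_pos.
    apply: continuousM; last exact: cx'.
    by apply: continuous_weight => //; case/andP: tm.
  apply/(continuous_within_itvP _ b0); split.
  + move=> t; rewrite in_itv /= => /andP[t0 tb]; apply: cW.
    by rewrite t0 (lt_trans tb).
  + rewrite [X in _ --> X]/extend0 eqxx.
    have Wx t : 0 < t < m -> weighted rho gamma x' t = weighted rho gamma x t.
      by move=> tm; rewrite /weighted xx'.
    rewrite (eq_value0 m0 Wx); apply: cvg_trans (weighted_cvg0 m0 xC').
    apply: near_eq_cvg; apply: near_right0 m0 _ => t /[dup] tm /andP[t0 _].
    by rewrite !extend0_pos // Wx.
  + by apply: cvg_at_left_filter; apply: cW; rewrite b0.
- move=> t t0; rewrite lte_fin => tm'.
  pose G s := RL (1 - alpha) v s - c' * s `^ q.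
  have sI : 0 < t `^ rho < M' by rewrite powR_gt0 //= pow_lt.
  have dP : is_derive t 1 (@powR R ^~ rho) (rho * t `^ (rho - 1)).
    exact: is_derive1_powR.
  have dC := is_deriveZ k (@is_derive1_comp _ G (@powR R ^~ rho) t _ _ (dv _ sI) dP).
  have dh : is_derive t 1 (hk_primitive rho alpha beta x') (t `^ (rho - 1) * phi t (x' t)).
    apply: (@is_derive_eq_oo _ (fun t => k * G (t `^ rho)) _ 0 m').
    - by rewrite t0.
    - move=> r /andP[r0 rm']; have rM' : r `^ rho < M' by exact: pow_lt.
      rewrite (hkE _ M' x' r hp tx' r0 rM').
      rewrite (eq_value0 m0 (kx' _)) -/y0 -/q /G /c'.
      rewrite (@eq_RL _ _ (rescale rho x') v); last by move=> s /andP[s0 _]; rewrite x'E.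
      by set w := RL _ _ _; field.
    - apply: (is_derive_eq dC); rewrite /GRing.scale /= /Phi /x' powR_root ?(ltW t0) //.
      by set w := phi _ _; set r := t `^ (rho - 1); field; rewrite kN rhoN.
  have [dh1 dh2] := dh; split; first exact: dh1.
  rewrite /hk_deriv derive1E dh2 mulrA -powRD; last by apply/implyP => _; rewrite gt_eqF.
  by rewrite addrA subrK subrr powRr0 mul1r.
- apply: cvg_trans xI; apply: near_eq_cvg.
  by apply: near_right0 m0 _ => t tm; rewrite kx'.
- by rewrite lte_fin.
- by move=> t t0; rewrite lte_fin => tm; rewrite xx' // t0.
Qed.

(** The graph of a function that is continuous up to the end point [m] stays in
    a compact rectangle. *)
Lemma continuation_bounded rho alpha beta (x0 : R) (phi : R -> R -> R) m x mu' x' zeta :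
  0 < rho -> 0 < zeta ->
  is_continuation rho alpha beta x0 phi m%:E x mu' x' ->
  exists E : set (R * R), [/\ bounded_set E, closed E,
    E `<=` [set z | zeta <= z.1] &
    forall t, zeta <= t -> (t%:E < m%:E)%E -> E (t, x t)].
Proof.
move=> rho0 z0 [[xC _ _] mm' xx'].
have [b mb bmu'] : exists2 b, m < b & (b%:E <= mu')%E.
  case: mu' mm' xC => [m'|_ _|//]; last by exists (m + 1); rewrite ?ltrDl ?leey.
  by rewrite lte_fin => mm' _; exists m'.
have cx' t : zeta <= t <= m -> {for t, continuous x'}.
  move=> /andP[zt tm]; have t0 : 0 < t by exact: lt_le_trans zt.
  apply: (@in_Cw_continuous rho (alpha + beta * (1 - alpha)) b) => //.
    move=> d d0 db; apply: xC => //; apply: lt_le_trans bmu'.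
    by rewrite lte_fin.
  by rewrite t0 (le_lt_trans tm).
have [K K0 hK] := continuous_segment_bound cx'.
exists ((fun z : R * R => z.1) @^-1` `[zeta, m]%classic `&`
        (fun z : R * R => z.2) @^-1` `[- K, K]%classic); split.
- exists (Num.max `|m| K); split; first exact: num_real.
  move=> L LK [t u] [] /=; rewrite !in_itv /= => /andP[zt tm] uK.
  have {LK} [Lm LK] : `|m| < L /\ K < L by move: LK; rewrite gt_max => /andP[].
  rewrite prod_normE /= ge_max; apply/andP; split.
    by have := ler_norm m; rewrite ler_norml; lra.
  by rewrite ler_norml; lra.
- apply: closedI; apply: closed_comp.
  + by move=> z _; exact: cvg_fst.
  + exact: interval_closed.
  + by move=> z _; exact: cvg_snd.
  + exact: interval_closed.
- by move=> [t u] [] /=; rewrite in_itv /= => /andP[].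
- move=> t zt tm; have t0 : 0 < t by exact: lt_le_trans zt.
  have tm' : t < m by rewrite -lte_fin.
  split; rewrite /= in_itv /=; first by rewrite zt ltW.
  by rewrite -ler_norml xx' //; apply: hK; rewrite zt ltW.
Qed.

End Solutions.

(** * The characterization of non-continuable solutions *)

Theorem theorem4p1 (R : realType) (alpha beta gamma rho x0 : R)
  (phi : R -> R -> R) (A lambda T : R) (mu : \bar R) (x : R -> R)
  (alpha_bounds : 0 < alpha < 1) (beta_bounds : 0 <= beta <= 1)
  (gammaE : gamma = alpha + beta * (1 - alpha)) (rho_gt0 : 0 < rho)
  (phi_continuous : {within [set p : R * R | 0 < p.1],
                      continuous (fun p : R * R => phi p.1 p.2)})
  (A_gt0 : 0 < A)
  (phi_lipschitz : forall t u v : R, 0 < t ->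
                     `|phi t u - phi t v| <= A * `|u - v|)
  (lambda_bounds : 0 <= lambda < 1) (T_gt0 : 0 < T)
  (M_map : continuous_bounded_map rho gamma T (opM lambda phi))
  (mu_gt0 : (0 < mu)%E)
  (x_solution : is_solution rho alpha beta x0 phi mu x) :
  non_continuable rho alpha beta x0 phi mu x <->
  exists zeta : R, [/\ 0 < zeta, (zeta%:E < (2^-1)%:E * mu)%E
    & forall E : set (R * R), bounded_set E -> closed E ->
        E `<=` [set p | zeta <= p.1] ->
        exists t : R, [/\ zeta <= t, (t%:E < mu)%E & ~ E (t, x t)]].
Proof.
case: mu mu_gt0 x_solution => [m|_ _|//].
  rewrite lte_fin => m0 x_solution.
  have [mu' [x' cont]] := continuation_exists rho_gt0 alpha_bounds beta_bounds
    phi_continuous (ltW A_gt0) phi_lipschitz m0 x_solution.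
  split=> [noncont|[zeta [zeta0 _ leaves]]].
    by case: noncont; exists mu', x'.
  have [E [bE cE zE gE]] := continuation_bounded rho_gt0 zeta0 cont.
  have [t [zt tm nE]] := leaves E bE cE zE.
  by case: nE; exact: gE.
split=> [_|_ [mu' [x' [_ + _]]]]; last by rewrite ltNge leey.
exists 1; split=> //; first by rewrite mulry gtr0_sg ?invr_gt0 // mul1e ltry.
move=> E [L [_ bE]] _ _; exists (Num.max 1 (L + 1)); split.
- by rewrite le_max lexx.
- by rewrite ltry.
- set t := Num.max _ _ => Et.
  have Lt : L < L + 2^-1 by rewrite ltrDl invr_gt0.
  have /= := bE _ Lt _ Et; rewrite prod_normE /= ge_max => /andP[tL _].
  have : L + 1 <= t by rewrite /t le_max lexx orbT.
  by have := ler_norm t; move: tL; lra.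
Qed.
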